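(* Let $\mathcal{B}$ be an abelian category with enough projective objects and enough injective objects, let $\mathsf{F}:\mathcal{B}\to\mathcal{B}$ be an additive right exact functor with $\mathsf{F}^2=0$, and let $\mathcal{B}\ltimes\mathsf{F}$ be the right trivial extension. Let $(\mathcal{X},\mathcal{Y})$ be a hereditary complete cotorsion pair in $\mathcal{B}$ such that $\omega=\mathcal{X}\cap\mathcal{Y}$ is contravariantly finite in $\mathcal{B}$. If $\mathbb{L}_1\mathsf{F}(X)=0$ for all $X\in\mathcal{X}$ and $\mathsf{F}(\mathcal{X})\subseteq\mathcal{Y}$, then $(\mathsf{T}(\mathcal{X}),\mathsf{U}^{-1}(\mathcal{Y}))$ is a hereditary complete cotorsion pair in $\mathcal{B}\ltimes\mathsf{F}$ with $\omega'=\mathsf{T}(\mathcal{X})\cap\mathsf{U}^{-1}(\mathcal{Y})$ contravariantly finite in $\mathcal{B}\ltimes\mathsf{F}$. Moreover, there is an equivalence of categories $\mathrm{Ho}(\mathcal{M}_{\omega})\simeq\mathrm{Ho}(\mathcal{M}_{\omega'})$.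
   Context: The right trivial extension $\mathcal{B}\ltimes\mathsf{F}$ has as objects the pairs $(X,f)$ with $X\in\mathcal{B}$ and $f:\mathsf{F}(X)\to X$ such that $f\circ\mathsf{F}(f)=0$ (automatic when $\mathsf{F}^2=0$); a morphism $(X,f)\to(Y,g)$ is a morphism $\alpha:X\to Y$ in $\mathcal{B}$ with $\alpha\circ f=g\circ\mathsf{F}(\alpha)$. It is an abelian category with enough projectives, and exactness is computed in $\mathcal{B}$. $\mathbb{L}_1\mathsf{F}$ is the first left derived functor of $\mathsf{F}$. For $X\in\mathcal{B}$, $\mathsf{T}(X)=\left(X\oplus\mathsf{F}(X),\left(\begin{smallmatrix}0&0\\1&0\end{smallmatrix}\right)\right)$, the matrix being a morphism $\mathsf{F}(X)\oplus\mathsf{F}^2(X)\to X\oplus\mathsf{F}(X)$; $\mathsf{T}(\mathcal{X})$ is the class of objects isomorphic to $\mathsf{T}(X)$ with $X\in\mathcal{X}$. $\mathsf{U}^{-1}(\mathcal{Y})=\{(X,f) : X\in\mathcal{Y}\}$. In an abelian category $\mathcal{A}$, a pair $(\mathcal{C},\mathcal{D})$ of classes is a cotorsion pair if $\mathcal{C}=\{C:\mathrm{Ext}^1_{\mathcal{A}}(C,D)=0\ \forall D\in\mathcal{D}\}$ and $\mathcal{D}=\{D:\mathrm{Ext}^1_{\mathcal{A}}(C,D)=0\ \forall C\in\mathcal{C}\}$; it is complete if for every object $A$ there are exact sequences $0\to D\to C\to A\to0$ and $0\to A\to D'\to C'\to0$ with $C,C'\in\mathcal{C}$, $D,D'\in\mathcal{D}$;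 it is hereditary if $\mathrm{Ext}^i_{\mathcal{A}}(C,D)=0$ for all $i\ge1$, $C\in\mathcal{C}$, $D\in\mathcal{D}$. A class $\omega$ is contravariantly finite in $\mathcal{A}$ if for every object $A$ there is a morphism $X_A\to A$ with $X_A\in\omega$ through which every morphism $X\to A$ with $X\in\omega$ factors. For a hereditary complete cotorsion pair $(\mathcal{X},\mathcal{Y})$ in $\mathcal{A}$ with $\omega=\mathcal{X}\cap\mathcal{Y}$ contravariantly finite, $\mathcal{M}_\omega=(\mathrm{CoFib}_\omega,\mathrm{Fib}_\omega,\mathrm{Weq}_\omega)$ is the associated model structure on $\mathcal{A}$ (Beligiannis–Reiten): $\mathrm{CoFib}_\omega$ consists of the monomorphisms with cokernel in $\mathcal{X}$; $\mathrm{Fib}_\omega$ of the morphisms $f$ with $\mathrm{Hom}_{\mathcal{A}}(W,f)$ surjective for all $W\in\omega$; $\mathrm{Weq}_\omega$ of the composites $p\circ i$ with $i$ a split monomorphism with $\mathrm{Coker}(i)\in\omega$ and $p$ an epimorphism with $\mathrm{Ker}(p)\in\mathcal{Y}$. $\mathrm{Ho}(\mathcal{M}_\omega)=\mathcal{A}[\mathrm{Weq}_\omega^{-1}]$ is its homotopy category, which is known to be equivalent to the additive quotient $\mathcal{X}/\omega$. *)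

(* Defs.v *)
From HB Require Import structures.
From mathcomp Require Import all_boot ssralg boolp.

Set Implicit Arguments.
Unset Strict Implicit.
Unset Printing Implicit Defensive.

Import GRing.Theory.
Local Open Scope ring_scope.

Declare Scope cat_scope.
Delimit Scope cat_scope with cat.

Record category := Category {
  cat_obj :> Type;
  hom : cat_obj -> cat_obj -> Type;
  idm : forall X, hom X X;
  comp : forall X Y Z, hom Y Z -> hom X Y -> hom X Z;
  comp1m : forall X Y (f : hom X Y), comp (idm Y) f = f;
  compm1 : forall X Y (f : hom X Y), comp f (idm X) = f;
  compmA : forall X Y Z T (h : hom Z T) (g : hom Y Z) (f : hom X Y),
    comp h (comp g f) = comp (comp h g) f }.

Arguments hom {c} X Y.
Arguments idm {c} X.
Arguments comp {c X Y Z} g f.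

Notation "g ∘ f" := (comp g f) (at level 40, left associativity) : cat_scope.
Local Open Scope cat_scope.

Record functor (C D : category) := Functor {
  fobj :> C -> D;
  fmap : forall X Y : C, hom X Y -> hom (fobj X) (fobj Y);
  fmap1 : forall X : C, fmap (idm X) = idm (fobj X);
  fmapM : forall (X Y Z : C) (g : hom Y Z) (f : hom X Y),
    fmap (g ∘ f) = fmap g ∘ fmap f }.

Arguments fmap {C D} f {X Y} _ : rename.

Definition functor_id (C : category) : functor C C :=
  @Functor C C (fun X => X) (fun _ _ f => f) (fun _ => erefl)
    (fun _ _ _ _ _ => erefl).

Section FunctorComp.
Variables (C D E : category) (G : functor D E) (F : functor C D).

Lemma functor_comp1 (X : C) : fmap G (fmap F (idm X)) = idm (G (F X)).
Proof. by rewrite !fmap1. Qed.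

Lemma functor_compM (X Y Z : C) (g : hom Y Z) (f : hom X Y) :
  fmap G (fmap F (g ∘ f)) = fmap G (fmap F g) ∘ fmap G (fmap F f).
Proof. by rewrite !fmapM. Qed.

Definition functor_comp : functor C E :=
  @Functor C E (fun X => G (F X)) (fun _ _ f => fmap G (fmap F f))
    functor_comp1 functor_compM.
End FunctorComp.

Definition is_iso (C : category) (X Y : C) (f : hom X Y) : Prop :=
  exists g : hom Y X, g ∘ f = idm X /\ f ∘ g = idm Y.

Definition isomorphic (C : category) (X Y : C) : Prop :=
  exists f : hom X Y, is_iso f.

Definition nat_isomorphic (C D : category) (F G : functor C D) : Prop :=
  exists eta : forall X : C, hom (F X) (G X),
    (forall X : C, is_iso (eta X)) /\
    (forall (X Y : C) (f : hom X Y), eta Y ∘ fmap F f = fmap G f ∘ eta X).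

Definition cat_equivalent (C D : category) : Prop :=
  exists (F : functor C D) (G : functor D C),
    nat_isomorphic (functor_comp G F) (functor_id C) /\
    nat_isomorphic (functor_comp F G) (functor_id D).

Definition mono (C : category) (X Y : C) (f : hom X Y) : Prop :=
  forall (W : C) (g h : hom W X), f ∘ g = f ∘ h -> g = h.

Definition epi (C : category) (X Y : C) (f : hom X Y) : Prop :=
  forall (W : C) (g h : hom Y W), g ∘ f = h ∘ f -> g = h.

Definition split_mono (C : category) (X Y : C) (f : hom X Y) : Prop :=
  exists r : hom Y X, r ∘ f = idm X.

Definition projective (C : category) (P : C) : Prop :=
  forall (X Y : C) (e : hom X Y) (f : hom P Y),
    epi e -> exists g : hom P X, e ∘ g = f.

Definition injective_obj (C : category) (I : C) : Prop :=
  forall (X Y : C) (m : hom X Y) (f : hom X I),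
    mono m -> exists g : hom Y I, g ∘ m = f.

Definition enough_projectives (C : category) : Prop :=
  forall X : C, exists (P : C) (e : hom P X), projective P /\ epi e.

Definition enough_injectives (C : category) : Prop :=
  forall X : C, exists (I : C) (m : hom X I), injective_obj I /\ mono m.

Definition contravariantly_finite (C : category) (W : C -> Prop) : Prop :=
  forall A : C, exists (XA : C) (a : hom XA A), W XA /\
    forall (X : C) (f : hom X A), W X -> exists g : hom X XA, a ∘ g = f.

(* Localization C[W^-1]: the morphisms are the words in the morphisms of C    *)
(* and formal inverses of the elements of W, modulo the least congruence that *)
(* yields a category, makes C -> C[W^-1] a functor, and inverts W.            *)

Definition morphism_class (C : category) : Type :=
  forall X Y : C, hom X Y -> Prop.

Inductive loc_word (C : category) (W : morphism_class C) : C -> C -> Type :=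
| LMor X Y (f : hom X Y) : loc_word W X Y
| LInv X Y (s : hom X Y) (Ws : W X Y s) : loc_word W Y X
| LComp X Y Z (v : loc_word W Y Z) (u : loc_word W X Y) : loc_word W X Z.

Arguments LMor {C} W {X Y} f.
Arguments LInv {C W X Y} s Ws.
Arguments LComp {C W X Y Z} v u.

Inductive loc_rel (C : category) (W : morphism_class C) :
  forall X Y : C, loc_word W X Y -> loc_word W X Y -> Prop :=
| loc_refl X Y (u : loc_word W X Y) : loc_rel u u
| loc_sym X Y (u v : loc_word W X Y) : loc_rel u v -> loc_rel v u
| loc_trans X Y (u v w : loc_word W X Y) :
    loc_rel u v -> loc_rel v w -> loc_rel u w
| loc_congr X Y Z (v v' : loc_word W Y Z) (u u' : loc_word W X Y) :
    loc_rel v v' -> loc_rel u u' -> loc_rel (LComp v u) (LComp v' u')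
| loc_assoc X Y Z T (w : loc_word W Z T) (v : loc_word W Y Z)
    (u : loc_word W X Y) :
    loc_rel (LComp w (LComp v u)) (LComp (LComp w v) u)
| loc_1l X Y (u : loc_word W X Y) : loc_rel (LComp (LMor W (idm Y)) u) u
| loc_1r X Y (u : loc_word W X Y) : loc_rel (LComp u (LMor W (idm X))) u
| loc_comp X Y Z (g : hom Y Z) (f : hom X Y) :
    loc_rel (LComp (LMor W g) (LMor W f)) (LMor W (g ∘ f))
| loc_invl X Y (s : hom X Y) (Ws : W X Y s) :
    loc_rel (LComp (LInv s Ws) (LMor W s)) (LMor W (idm X))
| loc_invr X Y (s : hom X Y) (Ws : W X Y s) :
    loc_rel (LComp (LMor W s) (LInv s Ws)) (LMor W (idm Y)).

HB.instance Definition _ (C : category) (W : morphism_class C) (X Y : C) :=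
  gen_eqMixin (loc_word W X Y).
HB.instance Definition _ (C : category) (W : morphism_class C) (X Y : C) :=
  gen_choiceMixin (loc_word W X Y).

Section Localization.
Variables (C : category) (W : morphism_class C).
Local Open Scope quotient_scope.

Definition loc_relb (X Y : C) : rel (loc_word W X Y) :=
  fun u v => `[< loc_rel u v >].

Lemma loc_relb_equiv (X Y : C) : equiv_class_of (@loc_relb X Y).
Proof.
split=> [u|u v|v u w].
- exact/asboolP/loc_refl.
- by apply/asboolP/asboolP => /loc_sym.
- move=> /asboolP uv /asboolP vw; apply/asboolP; exact: loc_trans uv vw.
Qed.

Canonical loc_equiv (X Y : C) := EquivRelPack (loc_relb_equiv X Y).

Definition loc_hom (X Y : C) : Type := {eq_quot loc_equiv X Y}.

Lemma loc_homP (X Y : C) (u v : loc_word W X Y) :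
  \pi_(loc_hom X Y) u = \pi_(loc_hom X Y) v <-> loc_rel u v.
Proof. by split=> [/eqmodP/asboolP|uv] //; apply/eqmodP/asboolP. Qed.

Definition loc_idm (X : C) : loc_hom X X := \pi_(loc_hom X X) (LMor W (idm X)).

Definition loc_comp_hom (X Y Z : C) (g : loc_hom Y Z) (f : loc_hom X Y) :
  loc_hom X Z := \pi_(loc_hom X Z) (LComp (repr g) (repr f)).

Lemma loc_comp_homE (X Y Z : C) (v : loc_word W Y Z) (u : loc_word W X Y) :
  loc_comp_hom (\pi_(loc_hom Y Z) v) (\pi_(loc_hom X Y) u)
  = \pi_(loc_hom X Z) (LComp v u).
Proof. by apply/loc_homP/loc_congr; apply/loc_homP; rewrite reprK. Qed.

Lemma loc_comp1m (X Y : C) (f : loc_hom X Y) : loc_comp_hom (loc_idm Y) f = f.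
Proof.
by rewrite -[f]reprK loc_comp_homE; apply/loc_homP/loc_1l.
Qed.

Lemma loc_compm1 (X Y : C) (f : loc_hom X Y) : loc_comp_hom f (loc_idm X) = f.
Proof.
by rewrite -[f]reprK loc_comp_homE; apply/loc_homP/loc_1r.
Qed.

Lemma loc_compmA (X Y Z T : C) (h : loc_hom Z T) (g : loc_hom Y Z)
    (f : loc_hom X Y) :
  loc_comp_hom h (loc_comp_hom g f) = loc_comp_hom (loc_comp_hom h g) f.
Proof.
elim/quotW: f => f; elim/quotW: g => g; elim/quotW: h => h.
rewrite (loc_comp_homE g f) (loc_comp_homE h g) !loc_comp_homE.
by apply/loc_homP; apply: loc_assoc.
Qed.

Definition localization : category :=
  @Category C loc_hom loc_idm loc_comp_hom loc_comp1m loc_compm1 loc_compmA.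

Definition loc_functor_map (X Y : C) (f : hom X Y) :
  @hom localization X Y := \pi_(loc_hom X Y) (LMor W f).

Lemma loc_functor_mapM (X Y Z : C) (g : hom Y Z) (f : hom X Y) :
  loc_functor_map (g ∘ f) = loc_functor_map g ∘ loc_functor_map f.
Proof.
rewrite /loc_functor_map [RHS]loc_comp_homE; by apply/esym/loc_homP; apply: loc_comp.
Qed.

Definition loc_functor : functor C localization :=
  @Functor C localization (fun X => X) loc_functor_map (fun _ => erefl)
    loc_functor_mapM.
End Localization.

Record preadditive := Preadditive {
  preadd_cat :> category;
  hom_zmod : forall X Y : preadd_cat, GRing.Zmodule.axioms_ (hom X Y);
  compDl_ : forall (X Y Z : preadd_cat) (g h : hom Y Z) (f : hom X Y),
    let V (X Y : preadd_cat) : zmodType := GRing.Zmodule.Pack (hom_zmod X Y) in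
    @GRing.add (V Y Z) g h ∘ f = @GRing.add (V X Z) (g ∘ f) (h ∘ f);
  compDr_ : forall (X Y Z : preadd_cat) (h : hom Y Z) (f g : hom X Y),
    let V (X Y : preadd_cat) : zmodType := GRing.Zmodule.Pack (hom_zmod X Y) in
    h ∘ @GRing.add (V X Y) f g = @GRing.add (V X Z) (h ∘ f) (h ∘ g) }.

HB.instance Definition _ (A : preadditive) (X Y : A) :
  GRing.Zmodule.axioms_ (hom X Y) := hom_zmod X Y.

Lemma compDl (A : preadditive) (X Y Z : A) (g h : hom Y Z) (f : hom X Y) :
  (g + h) ∘ f = g ∘ f + h ∘ f.
Proof. exact: compDl_. Qed.

Lemma compDr (A : preadditive) (X Y Z : A) (h : hom Y Z) (f g : hom X Y) :
  h ∘ (f + g) = h ∘ f + h ∘ g.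
Proof. exact: compDr_. Qed.

Section PreadditiveTheory.
Variable A : preadditive.
Implicit Types X Y Z : A.

Lemma comp0m X Y Z (f : hom X Y) : (0 : hom Y Z) ∘ f = 0.
Proof. by apply: (@addIr _ ((0 : hom Y Z) ∘ f)); rewrite -compDl !add0r. Qed.

Lemma compm0 X Y Z (h : hom Y Z) : h ∘ (0 : hom X Y) = 0.
Proof. by apply: (@addIr _ (h ∘ (0 : hom X Y))); rewrite -compDr !add0r. Qed.

Lemma compNm X Y Z (g : hom Y Z) (f : hom X Y) : (- g) ∘ f = - (g ∘ f).
Proof. by apply: (@addIr _ (g ∘ f)); rewrite -compDl !addNr comp0m. Qed.

Lemma compmN X Y Z (g : hom Y Z) (f : hom X Y) : g ∘ (- f) = - (g ∘ f).
Proof. by apply: (@addIr _ (g ∘ f)); rewrite -compDr !addNr compm0. Qed.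
End PreadditiveTheory.

Record additive_functor (A B : preadditive) := AdditiveFunctor {
  addf_functor :> functor A B;
  fmapD : forall (X Y : A) (f g : hom X Y),
    fmap addf_functor (f + g) = fmap addf_functor f + fmap addf_functor g }.

Section AdditiveFunctorTheory.
Variables (A B : preadditive) (F : additive_functor A B).

Lemma fmap0 (X Y : A) : fmap F (0 : hom X Y) = 0.
Proof. by apply: (@addIr _ (fmap F (0 : hom X Y))); rewrite -fmapD !add0r. Qed.

Lemma fmapN (X Y : A) (f : hom X Y) : fmap F (- f) = - fmap F f.
Proof. by apply: (@addIr _ (fmap F f)); rewrite -fmapD !addNr fmap0. Qed.
End AdditiveFunctorTheory.

Section Abelian.
Variable A : preadditive.
Implicit Types X Y Z : A.

Definition is_zero_obj Z : Prop :=
  (forall X (f : hom X Z), f = 0) /\ (forall X (f : hom Z X), f = 0).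

Record biproduct X Y := Biproduct {
  bip_obj :> A;
  bip_in1 : hom X bip_obj;
  bip_in2 : hom Y bip_obj;
  bip_pr1 : hom bip_obj X;
  bip_pr2 : hom bip_obj Y;
  bip_pr1_in1 : bip_pr1 ∘ bip_in1 = idm X;
  bip_pr2_in2 : bip_pr2 ∘ bip_in2 = idm Y;
  bip_pr1_in2 : bip_pr1 ∘ bip_in2 = 0;
  bip_pr2_in1 : bip_pr2 ∘ bip_in1 = 0;
  bip_sum : bip_in1 ∘ bip_pr1 + bip_in2 ∘ bip_pr2 = idm bip_obj }.

Definition is_kernel X Y (f : hom X Y) K (k : hom K X) : Prop :=
  f ∘ k = 0 /\
  forall W (t : hom W X), f ∘ t = 0 -> exists! u : hom W K, k ∘ u = t.

Definition is_cokernel X Y (f : hom X Y) C (c : hom Y C) : Prop :=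
  c ∘ f = 0 /\
  forall W (t : hom Y W), t ∘ f = 0 -> exists! u : hom C W, u ∘ c = t.

Definition abelian : Prop :=
  [/\ exists Z, is_zero_obj Z,
      forall X Y, inhabited (biproduct X Y),
      forall X Y (f : hom X Y), exists K (k : hom K X), is_kernel f k,
      forall X Y (f : hom X Y), exists C (c : hom Y C), is_cokernel f c &
      (forall X Y (m : hom X Y), mono m ->
         exists Z (g : hom Y Z), is_kernel g m) /\
      (forall X Y (e : hom X Y), epi e ->
         exists W (g : hom W X), is_cokernel g e)].

Definition is_image X Y (f : hom X Y) I (i : hom I Y) : Prop :=
  exists C (c : hom Y C), is_cokernel f c /\ is_kernel c i.

Definition exact X Y Z (f : hom X Y) (g : hom Y Z) : Prop :=
  exists I (i : hom I Y), is_image f i /\ is_kernel g i.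

Definition short_exact X Y Z (f : hom X Y) (g : hom Y Z) : Prop :=
  [/\ mono f, exact f g & epi g].

Definition is_homology X Y Z (f : hom X Y) (g : hom Y Z) H : Prop :=
  exists K (k : hom K Y) (f' : hom X K) (c : hom K H),
    [/\ is_kernel g k, k ∘ f' = f & is_cokernel f' c].

Record proj_resolution X := ProjResolution {
  res_obj :> nat -> A;
  res_d : forall n, hom (res_obj n.+1) (res_obj n);
  res_aug : hom (res_obj 0) X;
  res_proj : forall n, projective (res_obj n);
  res_aug_epi : epi res_aug;
  res_exact0 : exact (res_d 0) res_aug;
  res_exactS : forall n, exact (res_d n.+1) (res_d n) }.

(* Ext^n(X, D) = 0, i.e. H^n(Hom(P, D)) = 0 for projective resolutions P of X *)
Definition Ext_zero (n : nat) X D : Prop :=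
  forall (P : proj_resolution X) (phi : hom (P n) D),
    phi ∘ res_d P n = 0 ->
    match n return hom (P n) D -> Prop with
    | 0 => fun phi => phi = 0
    | m.+1 => fun phi => exists psi : hom (P m) D, psi ∘ res_d P m = phi
    end phi.

Definition cotorsion_pair (C D : A -> Prop) : Prop :=
  (forall X, C X <-> forall Y, D Y -> Ext_zero 1 X Y) /\
  (forall Y, D Y <-> forall X, C X -> Ext_zero 1 X Y).

Definition complete_pair (C D : A -> Prop) : Prop :=
  forall X,
    (exists Y1 X1 (f : hom Y1 X1) (g : hom X1 X),
       [/\ short_exact f g, C X1 & D Y1]) /\
    (exists Y2 X2 (f : hom X Y2) (g : hom Y2 X2),
       [/\ short_exact f g, C X2 & D Y2]).

Definition hereditary_pair (C D : A -> Prop) : Prop :=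
  forall n X Y, C X -> D Y -> Ext_zero n.+1 X Y.

End Abelian.

Definition right_exact (A B : preadditive) (F : functor A B) : Prop :=
  forall (X Y Z : A) (f : hom X Y) (g : hom Y Z), short_exact f g ->
    exact (fmap F f) (fmap F g) /\ epi (fmap F g).

Definition is_left_derived (A B : preadditive) (F : functor A B)
    (n : nat) (X : A) (L : B) : Prop :=
  exists P : proj_resolution X,
    match n with
    | 0 => exists c : hom (F (P 0)) L, is_cokernel (fmap F (res_d P 0)) c
    | m.+1 => is_homology (fmap F (res_d P m.+1)) (fmap F (res_d P m)) L
    end.

Definition left_derived_zero (A B : preadditive) (F : functor A B)
    (n : nat) (X : A) : Prop :=
  forall L : B, is_left_derived F n X L -> is_zero_obj L.

Section TrivialExtension.
Variables (B : preadditive) (F : additive_functor B B).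

Record triv_obj := TrivObj {
  triv_car : B;
  triv_map : hom (F triv_car) triv_car;
  triv_sq : triv_map ∘ fmap F triv_map = 0 }.

Definition triv_pred (M N : triv_obj) : pred (hom (triv_car M) (triv_car N)) :=
  fun a => a ∘ triv_map M == triv_map N ∘ fmap F a.

Lemma triv_predP (M N : triv_obj) : zmod_closed (@triv_pred M N).
Proof.
split=> [|a b]; rewrite !unfold_in /triv_pred.
  by rewrite fmap0 comp0m compm0.
move=> /eqP ea /eqP eb.
by rewrite compDl compNm ea eb fmapD fmapN compDr compmN.
Qed.

HB.instance Definition _ (M N : triv_obj) :=
  GRing.isZmodClosed.Build _ (@triv_pred M N) (@triv_predP M N).

Record triv_hom (M N : triv_obj) := TrivHom {
  triv_val :> hom (triv_car M) (triv_car N);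
  triv_valP : triv_val \in @triv_pred M N }.

HB.instance Definition _ (M N : triv_obj) := [isSub for @triv_val M N].
HB.instance Definition _ (M N : triv_obj) := [Choice of triv_hom M N by <:].
HB.instance Definition _ (M N : triv_obj) :=
  [SubChoice_isSubZmodule of triv_hom M N by <:].

Lemma triv_idP (M : triv_obj) : idm (triv_car M) \in @triv_pred M M.
Proof. by rewrite unfold_in /triv_pred fmap1 comp1m compm1. Qed.

Lemma triv_compP (M N L : triv_obj) (g : triv_hom N L) (f : triv_hom M N) :
  triv_val g ∘ triv_val f \in @triv_pred M L.
Proof.
case: g f => g /eqP eg [f /eqP ef] /=; rewrite unfold_in /triv_pred.
by rewrite -compmA ef compmA eg -compmA fmapM.
Qed.

Definition triv_idm (M : triv_obj) : triv_hom M M := TrivHom (triv_idP M).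

Definition triv_comp (M N L : triv_obj) (g : triv_hom N L) (f : triv_hom M N) :
  triv_hom M L := TrivHom (triv_compP g f).

Lemma triv_comp1m (M N : triv_obj) (f : triv_hom M N) :
  triv_comp (triv_idm N) f = f.
Proof. by apply: val_inj; rewrite /= comp1m. Qed.

Lemma triv_compm1 (M N : triv_obj) (f : triv_hom M N) :
  triv_comp f (triv_idm M) = f.
Proof. by apply: val_inj; rewrite /= compm1. Qed.

Lemma triv_compmA (M N L K : triv_obj) (h : triv_hom L K) (g : triv_hom N L)
    (f : triv_hom M N) :
  triv_comp h (triv_comp g f) = triv_comp (triv_comp h g) f.
Proof. by apply: val_inj; rewrite /= compmA. Qed.

Definition triv_cat : category :=
  @Category triv_obj triv_hom triv_idm triv_comp
    triv_comp1m triv_compm1 triv_compmA.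

Lemma triv_compDl (M N L : triv_obj) (g h : triv_hom N L) (f : triv_hom M N) :
  triv_comp (g + h) f = triv_comp g f + triv_comp h f.
Proof. by apply: val_inj; rewrite /= compDl. Qed.

Lemma triv_compDr (M N L : triv_obj) (h : triv_hom N L) (f g : triv_hom M N) :
  triv_comp h (f + g) = triv_comp h f + triv_comp h g.
Proof. by apply: val_inj; rewrite /= compDr. Qed.

Definition triv_ext : preadditive :=
  @Preadditive triv_cat (fun M N => GRing.Zmodule.class (triv_hom M N))
    triv_compDl triv_compDr.

(* The matrix ((0, 0), (1, 0)) : F X (+) F (F X) -> X (+) F X, where          *)
(* F (X (+) F X) is identified with F X (+) F (F X).                          *)
Definition T_map (X : B) (S : biproduct X (F X)) : hom (F S) S :=
  bip_in2 S ∘ fmap F (bip_pr1 S).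

Lemma T_map_sq (X : B) (S : biproduct X (F X)) :
  T_map S ∘ fmap F (T_map S) = 0.
Proof.
rewrite /T_map -compmA fmapM (compmA _ _ (fmap F (fmap F _))) -fmapM.
by rewrite bip_pr1_in2 fmap0 comp0m compm0.
Qed.

Definition T_obj (X : B) (S : biproduct X (F X)) : triv_ext :=
  TrivObj (T_map_sq S).

Definition T_class (C : B -> Prop) (M : triv_ext) : Prop :=
  exists (X : B) (S : biproduct X (F X)), C X /\ isomorphic M (T_obj S).

Definition Uinv_class (D : B -> Prop) (M : triv_ext) : Prop :=
  D (triv_car M).

End TrivialExtension.

Arguments T_class {B} F C M.
Arguments Uinv_class {B} F D M.

Record model_classes (A : category) := ModelClasses {
  CoFib : morphism_class A;
  Fib : morphism_class A;
  Weq : morphism_class A }.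

Definition Ho (A : category) (M : model_classes A) : category :=
  localization (Weq M).

Section ModelOmega.
Variables (A : preadditive) (C D : A -> Prop).

Definition core (X : A) : Prop := C X /\ D X.

Definition cofib_omega (X Y : A) (f : hom X Y) : Prop :=
  mono f /\ exists (Z : A) (c : hom Y Z), is_cokernel f c /\ C Z.

Definition fib_omega (X Y : A) (f : hom X Y) : Prop :=
  forall (W : A) (g : hom W Y), core W -> exists h : hom W X, f ∘ h = g.

Definition weq_omega (X Y : A) (f : hom X Y) : Prop :=
  exists (Z : A) (i : hom X Z) (p : hom Z Y),
    [/\ f = p ∘ i,
        split_mono i,
        exists (W : A) (c : hom Z W), is_cokernel i c /\ core W,
        epi p &
        exists (K : A) (k : hom K Z), is_kernel p k /\ D K].

Definition M_omega : model_classes A :=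
  ModelClasses cofib_omega fib_omega weq_omega.

End ModelOmega.

(* Main.v *)
(* The functor T is left adjoint to the exact functor U forgetting the structure
   map, and it is exact on short exact sequences ending in X because L_1 F
   vanishes there; comparing projective resolutions gives
   Ext^1(T X, N) = Ext^1(X, U N).  An object M is in T(X) exactly when its
   structure map F M -> M is a split mono with cokernel in X, a property
   inherited by retracts.  The special approximations of N are the transpose
   T X -> N of a special precover of U N, whose kernel is an extension of F X by
   an object of Y, and the pushout along the counit T U N -> N of
   T applied to a special preenvelope of U N.

   A functor inverts Weq as soon as it inverts the epimorphisms with kernel in
   Y, since the split monos in question have retractions of this kind.  Hence U
   and M |-> T (X_M), with X_M -> M a special precover, descend to the homotopy
   categories: lifts to precovers are unique up to morphisms through the core,
   and these vanish in the localization.  The morphisms T X_M = X_M (+) F X_M ->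
   X_M -> M and T (X_(U N)) -> N are epimorphisms with kernel in the right-hand
   class, and provide the natural isomorphisms. *)

From HB Require Import structures.
Require Import Defs.
From mathcomp Require Import all_boot ssralg boolp.

Set Implicit Arguments.
Unset Strict Implicit.
Unset Printing Implicit Defensive.

Import GRing.Theory.
Local Open Scope ring_scope.
Local Open Scope cat_scope.

Arguments proj_resolution {A} X.

(** * Kernels, cokernels and biproducts in preadditive categories *)

Lemma comp_eq (C : category) (X Y Z T : C) (g : hom Y Z) (f : hom X Y)
    (h : hom X Z) (k : hom Z T) : g ∘ f = h -> k ∘ g ∘ f = k ∘ h.
Proof. by move=> <-; rewrite compmA. Qed.

Lemma compBl (A : preadditive) (X Y Z : A) (g h : hom Y Z) (f : hom X Y) :
  (g - h) ∘ f = g ∘ f - h ∘ f.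
Proof. by rewrite compDl compNm. Qed.

Lemma compBr (A : preadditive) (X Y Z : A) (h : hom Y Z) (f g : hom X Y) :
  h ∘ (f - g) = h ∘ f - h ∘ g.
Proof. by rewrite compDr compmN. Qed.

Section Preadditive.
Variable A : preadditive.
Implicit Types X Y Z : A.

Lemma mono0P X Y (f : hom X Y) :
  mono f <-> forall W (x : hom W X), f ∘ x = 0 -> x = 0.
Proof.
split=> [fm W x fx0 | f0 W g h fgh]; first by apply: fm; rewrite fx0 compm0.
by apply/eqP; rewrite -subr_eq0; apply/eqP/f0; rewrite compBr fgh subrr.
Qed.

Lemma epi0P X Y (f : hom X Y) :
  epi f <-> forall W (x : hom Y W), x ∘ f = 0 -> x = 0.
Proof.
split=> [fm W x fx0 | f0 W g h fgh]; first by apply: fm; rewrite fx0 comp0m.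
by apply/eqP; rewrite -subr_eq0; apply/eqP/f0; rewrite compBl fgh subrr.
Qed.

Lemma split_epi X Y (f : hom X Y) (s : hom Y X) : f ∘ s = idm Y -> epi f.
Proof.
by move=> fs; apply/epi0P => W x /(congr1 (fun y => y ∘ s));
  rewrite -compmA fs compm1 comp0m.
Qed.

Lemma split_mono_mono X Y (f : hom X Y) (r : hom Y X) : r ∘ f = idm X -> mono f.
Proof.
by move=> rf; apply/mono0P => W x /(congr1 (fun y => r ∘ y));
  rewrite compmA rf comp1m compm0.
Qed.

Lemma kernel_mono X Y (f : hom X Y) K (k : hom K X) : is_kernel f k -> mono k.
Proof.
move=> [fk0 kU]; apply/mono0P => W x kx0.
have [u [_ uU]] := kU W 0 (compm0 _ _).
by rewrite -(uU x) // -(uU 0) // compm0.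
Qed.

Lemma cokernel_epi X Y (f : hom X Y) C (c : hom Y C) : is_cokernel f c -> epi c.
Proof.
move=> [fk0 kU]; apply/epi0P => W x kx0.
have [u [_ uU]] := kU W 0 (comp0m _ _).
by rewrite -(uU x) // -(uU 0) // comp0m.
Qed.

Lemma kernel_lift X Y (f : hom X Y) K (k : hom K X) W (t : hom W X) :
  is_kernel f k -> f ∘ t = 0 -> exists u, k ∘ u = t.
Proof. by move=> [_ kU] /kU [u [ut _]]; exists u. Qed.

Lemma cokernel_desc X Y (f : hom X Y) C (c : hom Y C) W (t : hom Y W) :
  is_cokernel f c -> t ∘ f = 0 -> exists u, u ∘ c = t.
Proof. by move=> [_ kU] /kU [u [ut _]]; exists u. Qed.

Lemma kernelI X Y (f : hom X Y) K (k : hom K X) :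
  mono k -> f ∘ k = 0 ->
  (forall W (t : hom W X), f ∘ t = 0 -> exists u, k ∘ u = t) -> is_kernel f k.
Proof.
move=> km fk0 kU; split=> // W t /kU [u ut]; exists u; split=> // v vt.
by apply: km; rewrite ut vt.
Qed.

Lemma cokernelI X Y (f : hom X Y) C (c : hom Y C) :
  epi c -> c ∘ f = 0 ->
  (forall W (t : hom Y W), t ∘ f = 0 -> exists u, u ∘ c = t) -> is_cokernel f c.
Proof.
move=> km fk0 kU; split=> // W t /kU [u ut]; exists u; split=> // v vt.
by apply: km; rewrite ut vt.
Qed.

(** Working form of [short_exact] in which no image occurs; in an abelian category the two agree by
    [short_exactP]. *)
Definition ses X Y Z (f : hom X Y) (g : hom Y Z) := is_kernel g f /\ epi g.

Lemma bip_ses X Y (S : biproduct X Y) : ses (bip_in1 S) (bip_pr2 S).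
Proof.
split; last exact: split_epi (bip_pr2_in2 S).
apply: kernelI; first exact: split_mono_mono (bip_pr1_in1 S).
  exact: bip_pr2_in1.
move=> W t t0; exists (bip_pr1 S ∘ t).
by rewrite compmA -[RHS]comp1m -(bip_sum S) compDl -(compmA (bip_in2 S)) t0 compm0 addr0.
Qed.

Definition bip_swap X Y (S : biproduct X Y) : biproduct Y X.
Proof.
apply: (@Biproduct _ _ _ S (bip_in2 S) (bip_in1 S) (bip_pr2 S) (bip_pr1 S)).
- exact: bip_pr2_in2.
- exact: bip_pr1_in1.
- exact: bip_pr2_in1.
- exact: bip_pr1_in2.
- by rewrite addrC bip_sum.
Defined.

Lemma bip_ext X Y (S : biproduct X Y) Z (f g : hom S Z) :
  f ∘ bip_in1 S = g ∘ bip_in1 S -> f ∘ bip_in2 S = g ∘ bip_in2 S -> f = g.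
Proof.
move=> e1 e2; rewrite -[f]compm1 -[g]compm1 -(bip_sum S) !compDr !compmA.
by rewrite e1 e2.
Qed.

Lemma bip_elt_ext X Y (S : biproduct X Y) Z (f g : hom Z S) :
  bip_pr1 S ∘ f = bip_pr1 S ∘ g -> bip_pr2 S ∘ f = bip_pr2 S ∘ g -> f = g.
Proof.
move=> e1 e2; rewrite -[f]comp1m -[g]comp1m -(bip_sum S) !compDl -!compmA.
by rewrite e1 e2.
Qed.

End Preadditive.

(** * Abelian categories with enough projectives *)

Section Abelian.
Variables (A : preadditive) (hA : abelian A) (hP : enough_projectives A).
Implicit Types X Y Z : A.

Lemma has_kernel X Y (f : hom X Y) : exists K (k : hom K X), is_kernel f k.
Proof. by case: hA. Qed.

Lemma has_cokernel X Y (f : hom X Y) : exists C (c : hom Y C), is_cokernel f c.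
Proof. by case: hA. Qed.

Lemma has_biproduct X Y : inhabited (biproduct X Y).
Proof. by case: hA. Qed.

(** Abelianness only provides some [g] with kernel [f]; this [g] factors through [c], so whatever
    [c] kills is killed by [g] and factors through [f]. *)
Lemma mono_is_kernel X Y (f : hom X Y) C (c : hom Y C) :
  mono f -> is_cokernel f c -> is_kernel c f.
Proof.
move=> fm cf; have [_ _ _ _ [H _]] := hA; have [Z [g gf]] := H _ _ _ fm.
apply: kernelI => //; first by case: cf.
move=> W t ct0; apply: (kernel_lift gf).
have [u <-] := cokernel_desc cf gf.1.
by rewrite -compmA ct0 compm0.
Qed.

Lemma epi_is_cokernel X Y (f : hom X Y) K (k : hom K X) :
  epi f -> is_kernel f k -> is_cokernel k f.
Proof.
move=> fm cf; have [_ _ _ _ [_ H]] := hA; have [Z [g gf]] := H _ _ _ fm.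
apply: cokernelI => //; first by case: cf.
move=> W t ct0; apply: (cokernel_desc gf).
have [u <-] := kernel_lift cf gf.1.
by rewrite compmA ct0 comp0m.
Qed.

Lemma mono_epi_iso X Y (f : hom X Y) : mono f -> epi f -> is_iso f.
Proof.
move=> fm fe; have [C [c cf]] := has_cokernel f.
have c0 : c = 0 by have /epi0P := fe; apply; case: cf.
have [g fg] : exists g, f ∘ g = idm Y.
  by apply: (kernel_lift (mono_is_kernel fm cf)); rewrite c0 comp0m.
by exists g; split=> //; apply: fm; rewrite compmA fg comp1m compm1.
Qed.

Lemma ses_cokernel X Y Z (f : hom X Y) (g : hom Y Z) : ses f g -> is_cokernel f g.
Proof. by case=> fk ge; exact: epi_is_cokernel. Qed.

Lemma short_exactP X Y Z (f : hom X Y) (g : hom Y Z) : short_exact f g <-> ses f g.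
Proof.
split=> [[fm [I [i [[C [c [cf ci]]] gi]]] ge] | [fk ge]].
  split=> //; have fk := mono_is_kernel fm cf.
  apply: kernelI => //.
    by have [u <-] := kernel_lift ci cf.1; rewrite compmA gi.1 comp0m.
  move=> W t /(kernel_lift gi) [v <-]; apply: (kernel_lift fk).
  by rewrite compmA ci.1 comp0m.
split=> //; first exact: kernel_mono fk.
have [C [c cf]] := has_cokernel f.
by exists _, f; split=> //; exists C, c; split=> //; apply: mono_is_kernel (kernel_mono fk) cf.
Qed.

Lemma ses_of_epi X Y (g : hom X Y) : epi g -> exists K (k : hom K X), ses k g.
Proof. by move=> ge; have [K [k kg]] := has_kernel g; exists K, k. Qed.

(* Morphisms out of projective objects serve as elements: exactness, monos and
   epis are detected on them without changing the domain. *)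

Lemma epi_eltP X Y (f : hom X Y) :
  (forall P (y : hom P Y), projective P -> exists x, f ∘ x = y) -> epi f.
Proof.
move=> H; have [P [e [Pp ee]]] := hP Y; have [x xe] := H _ e Pp.
by apply/epi0P => W t t0; have /epi0P := ee; apply; rewrite -xe compmA t0 comp0m.
Qed.

Lemma mono_eltP X Y (f : hom X Y) :
  (forall P (x : hom P X), projective P -> f ∘ x = 0 -> x = 0) -> mono f.
Proof.
move=> H; apply/mono0P => W x fx0; have [P [e [Pp /epi0P ee]]] := hP W.
by apply: ee; apply: H => //; rewrite compmA fx0 comp0m.
Qed.

Lemma elt_eq0 X Y (f : hom X Y) :
  (forall P (x : hom P X), projective P -> f ∘ x = 0) -> f = 0.
Proof.
by move=> H; have [P [e [Pp /epi0P ee]]] := hP X; apply: ee; apply: H.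
Qed.

Lemma epi_desc X Y (e : hom X Y) Z (t : hom X Z) : epi e ->
  (forall P (x : hom P X), projective P -> e ∘ x = 0 -> t ∘ x = 0) ->
  exists u, u ∘ e = t.
Proof.
move=> ee H; have [K [k ke]] := ses_of_epi ee.
apply: (cokernel_desc (ses_cokernel ke)); apply: elt_eq0 => P x Pp.
by rewrite -compmA; apply: H => //; rewrite compmA ke.1.1 comp0m.
Qed.

(** The mono [k] is the kernel of its own cokernel [c], so [t] factors through [k] once [c ∘ t = 0],
    and this vanishing can be tested on projectives. *)
Lemma kernel_eltI X Y (f : hom X Y) K (k : hom K X) :
  mono k -> f ∘ k = 0 ->
  (forall P (t : hom P X), projective P -> f ∘ t = 0 -> exists u, k ∘ u = t) ->
  is_kernel f k.
Proof.
move=> km fk0 H; have [C [c ck]] := has_cokernel k.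
have kk := mono_is_kernel km ck.
apply: kernelI => // W t ft0; apply: (kernel_lift kk).
apply: elt_eq0 => P x Pp; have [|u ut] := H P (t ∘ x) Pp.
  by rewrite compmA ft0 comp0m.
by rewrite -compmA -ut compmA ck.1 comp0m.
Qed.

Lemma ses_eltI X Y Z (f : hom X Y) (g : hom Y Z) :
  g ∘ f = 0 ->
  (forall P (x : hom P X), projective P -> f ∘ x = 0 -> x = 0) ->
  (forall P (t : hom P Y), projective P -> g ∘ t = 0 -> exists u, f ∘ u = t) ->
  (forall P (y : hom P Z), projective P -> exists x, g ∘ x = y) ->
  ses f g.
Proof.
move=> gf0 /mono_eltP fm H /epi_eltP ge; split=> //; exact: kernel_eltI.
Qed.

Lemma ses_lift X Y Z (f : hom X Y) (g : hom Y Z) W (t : hom W Y) :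
  ses f g -> g ∘ t = 0 -> exists u, f ∘ u = t.
Proof. by case=> /kernel_lift H _; exact: H. Qed.

Lemma ses_desc X Y Z (f : hom X Y) (g : hom Y Z) W (t : hom Y W) :
  ses f g -> t ∘ f = 0 -> exists u, u ∘ g = t.
Proof. by move=> /ses_cokernel /cokernel_desc H; exact: H. Qed.

Lemma ses_mono0 X Y Z (f : hom X Y) (g : hom Y Z) W (t : hom W X) :
  ses f g -> f ∘ t = 0 -> t = 0.
Proof. by case=> /kernel_mono /mono0P H _; exact: H. Qed.

(** Trades exactness through images for lifting of elements. Forwards, an element killed by [g] lies
    in the image and lifts along the epi part of [f]. *)
Lemma exactP X Y Z (f : hom X Y) (g : hom Y Z) :
  exact f g <-> g ∘ f = 0 /\
    forall P (y : hom P Y), projective P -> g ∘ y = 0 -> exists x, f ∘ x = y.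
Proof.
split=> [[I [i [[C [c [cf ci]]] gi]]] | [gf0 H]].
  have [e fe] := kernel_lift ci cf.1.
  split; first by rewrite -fe compmA gi.1 comp0m.
  (* If [d ∘ e = 0], then [f] factors through the subobject [i ∘ k], where [k] is the kernel of [d].
     This subobject is the kernel of its cokernel [c'], which factors through [c] and so kills [i].
     Hence [k] is a split epi and [d = 0]. *)
  have ee : epi e.
    apply/epi0P => W d de0; have [K [k kd]] := has_kernel d.
    have [e' ee'] := kernel_lift kd de0.
    have im := kernel_mono ci; have km := kernel_mono kd.
    have ikm : mono (i ∘ k).
      by move=> V g1 g2; rewrite -!compmA => /im /km.
    have [C' [c' cik]] := has_cokernel (i ∘ k).
    have [w wc] : exists w, w ∘ c = c'.
      apply: (cokernel_desc cf); rewrite -fe -ee' (compmA i).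
      by rewrite compmA cik.1 comp0m.
    have [v iv] : exists v, i ∘ k ∘ v = i.
      apply: (kernel_lift (mono_is_kernel ikm cik)).
      by rewrite -wc -compmA ci.1 compm0.
    have kv : k ∘ v = idm I by apply: im; rewrite compmA iv compm1.
    by rewrite -[d]compm1 -kv compmA kd.1 comp0m.
  move=> P y Pp gy0; have [t it] := kernel_lift gi gy0.
  have [x ex] := Pp _ _ e t ee.
  by exists x; rewrite -fe -compmA ex it.
have [I [i gi]] := has_kernel g; have [C [c cf]] := has_cokernel f.
have im := kernel_mono gi.
exists I, i; split=> //; exists C, c; split=> //; apply: kernelI => //.
  apply: elt_eq0 => P x Pp; have [|y fy] := H P (i ∘ x) Pp.
    by rewrite compmA gi.1 comp0m.
  by rewrite -compmA -fy compmA cf.1 comp0m.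
move=> W t ct0; apply: (kernel_lift gi).
by have [u <-] := cokernel_desc cf gf0; rewrite -compmA ct0 compm0.
Qed.

(** * Vanishing of Ext^1 in terms of short exact sequences *)

Lemma pushout_ses X Y Z D (f : hom X Y) (g : hom Y Z) (t : hom X D) : ses f g ->
  exists E (j : hom D E) (q : hom E Z) (e : hom Y E),
    [/\ ses j q, e ∘ f = j ∘ t & q ∘ e = g].
Proof.
move=> fg; have [S] := has_biproduct Y D.
(* The pushout is the cokernel of [(f, -t)]. An element of [D] that dies there comes from some [u]
   in [X] with [f ∘ u = 0], hence is zero. *)
pose d := bip_in1 S ∘ f - bip_in2 S ∘ t.
have [E [c cd]] := has_cokernel d.
have ce := cokernel_epi cd.
have dm : mono d.
  apply: mono_eltP => P x _ dx0.
  apply: (ses_mono0 fg); rewrite -[f]comp1m -(bip_pr1_in1 S).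
  have := congr1 (fun y => bip_pr1 S ∘ y) dx0.
  by rewrite compm0 compmA compBr !compmA bip_pr1_in2 comp0m subr0.
have [q qc] : exists q, q ∘ c = g ∘ bip_pr1 S.
  apply: (cokernel_desc cd); rewrite compBr !compmA (comp_eq _ (bip_pr1_in1 S)).
  by rewrite (comp_eq _ (bip_pr1_in2 S)) compm1 fg.1.1 compm0 comp0m subr0.
have cf : c ∘ bip_in1 S ∘ f = c ∘ bip_in2 S ∘ t.
  by apply/eqP; rewrite -subr_eq0 -!compmA -compBr cd.1.
have qj : q ∘ (c ∘ bip_in2 S) = 0.
  by rewrite compmA qc (comp_eq _ (bip_pr1_in2 S)) compm0.
have qe : q ∘ (c ∘ bip_in1 S) = g.
  by rewrite compmA qc (comp_eq _ (bip_pr1_in1 S)) compm1.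
exists E, (c ∘ bip_in2 S), q, (c ∘ bip_in1 S); split=> //.
apply: ses_eltI => //.
- move=> P x Pp cx0.
  have [u du] : exists u, d ∘ u = bip_in2 S ∘ x.
    by apply: (kernel_lift (mono_is_kernel dm cd)); rewrite compmA.
  have fu0 : f ∘ u = 0.
    have := congr1 (fun y => bip_pr1 S ∘ y) du.
    rewrite !compmA bip_pr1_in2 comp0m compBr !compmA bip_pr1_in1 comp1m.
    by rewrite bip_pr1_in2 comp0m subr0.
  have u0 := ses_mono0 fg fu0.
  have := congr1 (fun y => bip_pr2 S ∘ y) du.
  by rewrite u0 !compm0 compmA bip_pr2_in2 comp1m.
- move=> P z Pp qz0; have [s cs] := Pp _ _ c z ce.
  have [u fu] : exists u, f ∘ u = bip_pr1 S ∘ s.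
    by apply: (ses_lift fg); rewrite compmA -qc -compmA cs.
  exists (bip_pr2 S ∘ s + t ∘ u).
  rewrite compDr (compmA _ t) -cf -(compmA _ f) fu -cs -[in RHS](comp1m s).
  by rewrite -(bip_sum S) compDl compDr !compmA addrC.
- move=> P z Pp; have [y gy] := Pp _ _ g z fg.2.
  by exists (c ∘ bip_in1 S ∘ y); rewrite compmA qe.
Qed.

(** Vanishing of Ext^1 without a choice of resolution, as an extension property along all short
    exact sequences ending in [X]; [Ext_zero1P] identifies it with [Ext_zero 1]. *)
Definition ext1_zero X D := forall K E (f : hom K E) (g : hom E X),
  ses f g -> forall t : hom K D, exists s, s ∘ f = t.

(** Projectivity lifts [g0] to [a], which restricts to [b] on kernels. The square of [f0], [b], [a],
    [f] is then bicartesian, and the last sequence expresses this. *)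
Lemma comparison_ses X K E K0 P (f : hom K E) (g : hom E X) (f0 : hom K0 P)
    (g0 : hom P X) : ses f g -> ses f0 g0 -> projective P ->
  exists (a : hom P E) (b : hom K0 K), [/\ g ∘ a = g0, f ∘ b = a ∘ f0 &
    forall S : biproduct K P, ses (bip_in2 S ∘ f0 - bip_in1 S ∘ b)
                                  (f ∘ bip_pr1 S + a ∘ bip_pr2 S)].
Proof.
move=> fg fg0 Pp; have [a ga] := Pp _ _ g g0 fg.2.
have [|b fb] := @ses_lift _ _ _ _ _ _ (a ∘ f0) fg.
  by rewrite compmA ga fg0.1.1.
exists a, b; split=> // S; apply: ses_eltI.
- rewrite compDl !compBr !compmA (comp_eq _ (bip_pr1_in2 S)).
  rewrite (comp_eq _ (bip_pr1_in1 S)) (comp_eq _ (bip_pr2_in2 S)).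
  by rewrite (comp_eq _ (bip_pr2_in1 S)) !compm1 !compm0 !comp0m fb sub0r subr0 addNr.
- move=> Q x _ dx0; apply: (ses_mono0 fg0).
  have := congr1 (fun y => bip_pr2 S ∘ y) dx0.
  rewrite compm0 compmA compBr !compmA bip_pr2_in1 comp0m subr0.
  by rewrite bip_pr2_in2 comp1m.
- move=> Q t Qp; rewrite compDl => e0.
  have [u fu] : exists u, f0 ∘ u = bip_pr2 S ∘ t.
    apply: (ses_lift fg0); have := congr1 (fun y => g ∘ y) e0.
    by rewrite compDr !compmA fg.1.1 !comp0m add0r compm0 ga.
  exists u; apply: (@bip_elt_ext _ _ _ S); last first.
    by rewrite compmA compBr !compmA bip_pr2_in1 bip_pr2_in2 comp0m comp1m subr0.
  rewrite compmA compBr !compmA bip_pr1_in1 bip_pr1_in2 comp0m comp1m sub0r.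
  apply: (kernel_mono fg.1); rewrite compNm compmN compmA fb -(compmA a) fu.
  by apply/eqP; rewrite eq_sym -addr_eq0 !compmA e0.
- move=> Q y Qp; have [p gp] := Qp _ _ g0 (g ∘ y) fg0.2.
  have [|u fu] := @ses_lift _ _ _ _ _ _ (y - a ∘ p) fg.
    by rewrite compBr compmA ga gp subrr.
  exists (bip_in1 S ∘ u + bip_in2 S ∘ p).
  rewrite compDl !compDr !compmA (comp_eq _ (bip_pr1_in2 S)).
  rewrite (comp_eq _ (bip_pr1_in1 S)) (comp_eq _ (bip_pr2_in2 S)).
  rewrite (comp_eq _ (bip_pr2_in1 S)) !compm1 !compm0 !comp0m addr0 add0r.
  by rewrite fu subrK.
Qed.

(** One projective presentation decides the matter: given [t] on [K'], extend [t ∘ b] to [s] on [P].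
    Then [(t, s)] on the sum of [K'] and [P] vanishes on [K] and descends to [E']. *)
Lemma ext1_zero_proj X D K P (f : hom K P) (g : hom P X) :
  ses f g -> projective P -> (forall t : hom K D, exists s, s ∘ f = t) ->
  ext1_zero X D.
Proof.
move=> fg0 Pp H K' E f' g' fg t.
have [a [b [ga fb S]]] := comparison_ses fg fg0 Pp.
have [s sf] := H (t ∘ b); have [bp] := has_biproduct K' P.
have [|w wE] := @ses_desc _ _ _ _ _ _ (t ∘ bip_pr1 bp + s ∘ bip_pr2 bp) (S bp).
  rewrite compDl !compBr !compmA (comp_eq _ (bip_pr1_in2 _)).
  rewrite (comp_eq _ (bip_pr1_in1 _)) (comp_eq _ (bip_pr2_in2 _)).
  by rewrite (comp_eq _ (bip_pr2_in1 _)) !compm1 !compm0 !comp0m sub0r subr0 sf addNr.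
exists w; have := congr1 (fun y => y ∘ bip_in1 bp) wE.
rewrite !compDl -compmA compDl -!compmA !bip_pr2_in1 !bip_pr1_in1 !compm0.
by rewrite !compm1 !addr0.
Qed.

(** On a projective cover [P] of [X] a lift [a] exists. Its restriction to the kernel lands in [D]
    and extends to [P]; subtracting this extension makes [a] descend to [X]. *)
Lemma ext1_lift X D (e1 : ext1_zero X D) E G (f : hom D E) (g : hom E G)
    (x : hom X G) : ses f g -> exists s, g ∘ s = x.
Proof.
move=> fg; have [P [p [Pp pe]]] := hP X; have [K [k kp]] := ses_of_epi pe.
have [a ga] := Pp _ _ g (x ∘ p) fg.2.
have [|b fb] := @ses_lift _ _ _ _ _ _ (a ∘ k) fg.
  by rewrite compmA ga -compmA kp.1.1 compm0.
have [s sk] := e1 _ _ _ _ kp b.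
have [|w wp] := @ses_desc _ _ _ _ _ _ (a - f ∘ s) kp.
  by rewrite compBl -compmA sk fb subrr.
exists w; apply: pe; rewrite -compmA wp compBr ga compmA fg.1.1 comp0m.
by rewrite subr0.
Qed.

(** Lifting the identity of [X] splits the pushout of the sequence along [t], and the splitting
    turns the pushout map into an extension of [t]. *)
Lemma ext1_lift_inv X D :
  (forall E G (f : hom D E) (g : hom E G) (x : hom X G), ses f g ->
     exists s, g ∘ s = x) -> ext1_zero X D.
Proof.
move=> H K E f g fg t; have [Z [j [q [e [jq ef qe]]]]] := pushout_ses t fg.
have [s qs] := H _ _ _ _ (idm X) jq.
have [|w jw] := @ses_lift _ _ _ _ _ _ (e - s ∘ g) jq.
  by rewrite compBr compmA qs comp1m qe subrr.
exists w; apply: (kernel_mono jq.1); rewrite compmA jw compBl ef.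
by rewrite -compmA fg.1.1 compm0 subr0.
Qed.

Lemma ext1_retract_l X X' D (i : hom X' X) (r : hom X X') :
  r ∘ i = idm X' -> ext1_zero X D -> ext1_zero X' D.
Proof.
move=> ri e1; apply: ext1_lift_inv => E G f g x fg.
have [s gs] := ext1_lift e1 (x ∘ r) fg.
by exists (s ∘ i); rewrite compmA gs -compmA ri compm1.
Qed.

Lemma ext1_retract_r X D D' (i : hom D' D) (r : hom D D') :
  r ∘ i = idm D' -> ext1_zero X D -> ext1_zero X D'.
Proof.
move=> ri e1 K E f g fg t; have [s gs] := e1 _ _ _ _ fg (i ∘ t).
by exists (r ∘ s); rewrite -compmA gs compmA ri comp1m.
Qed.

Lemma ext1_extension_r X D1 D D2 (i : hom D1 D) (q : hom D D2) : ses i q ->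
  ext1_zero X D1 -> ext1_zero X D2 -> ext1_zero X D.
Proof.
move=> iq e1 e2; have [P [p [Pp pe]]] := hP X.
have [K [k kp]] := ses_of_epi pe; apply: (ext1_zero_proj kp Pp) => t.
have [s sk] := e2 _ _ _ _ kp (q ∘ t).
have [s' qs'] := Pp _ _ q s iq.2.
have [|w jw] := @ses_lift _ _ _ _ _ _ (t - s' ∘ k) iq.
  by rewrite compBr compmA qs' sk subrr.
have [v vk] := e1 _ _ _ _ kp w.
by exists (i ∘ v + s'); rewrite compDl -compmA vk jw subrK.
Qed.

(** The kernel [L] of [q ∘ g] is an extension of [X1] by [K], with quotient [X2] in [E]. So [t]
    extends first from [K] to [L], then from [L] to [E]. *)
Lemma ext1_extension_l X1 X X2 D (i : hom X1 X) (q : hom X X2) : ses i q ->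
  ext1_zero X1 D -> ext1_zero X2 D -> ext1_zero X D.
Proof.
move=> iq e1 e2 K E f g fg t.
have qge : epi (q ∘ g) by move=> W a b; rewrite !compmA => /fg.2 /iq.2.
have [L [l lq]] := ses_of_epi qge.
have [|g1 ig1] := @ses_lift _ _ _ _ _ _ (g ∘ l) iq; first by rewrite compmA lq.1.1.
have [|f1 lf1] := @ses_lift _ _ _ _ _ _ f lq.
  by rewrite -compmA fg.1.1 compm0.
have fg1 : ses f1 g1.
  apply: ses_eltI.
  - by apply: (kernel_mono iq.1); rewrite compmA ig1 -compmA lf1 fg.1.1 compm0.
  - move=> P x _ fx0; apply: (ses_mono0 fg).
    by rewrite -lf1 -compmA fx0 compm0.
  - move=> P x _ gx0; have [|u fu] := @ses_lift _ _ _ _ _ _ (l ∘ x) fg.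
      by rewrite compmA -ig1 -compmA gx0 compm0.
    by exists u; apply: (kernel_mono lq.1); rewrite compmA lf1.
  - move=> P y Pp; have [z gz] := Pp _ _ g (i ∘ y) fg.2.
    have [|w lw] := @ses_lift _ _ _ _ _ _ z lq.
      by rewrite -compmA gz compmA iq.1.1 comp0m.
    by exists w; apply: (kernel_mono iq.1); rewrite compmA ig1 -compmA lw.
have [s sf1] := e1 _ _ _ _ fg1 t.
have [r rl] := e2 _ _ _ _ lq s.
by exists r; rewrite -lf1 compmA rl.
Qed.

(** ** Projective resolutions and [Ext] *)

Lemma exists_resolution X : inhabited (proj_resolution X).
Proof.
(* A projective presentation is chosen for every object at once; the resolution iterates the syzygy
   [K], and each differential passes through a syzygy. *)
pose cover Z := {K : A & {P : A & {k : hom K P & {p : hom P Z |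
  ses k p /\ projective P}}}}.
have hc : forall Z, exists c : cover Z, True.
  move=> Z; have [P [p [Pp pe]]] := hP Z; have [K [k kp]] := ses_of_epi pe.
  by exists (existT _ K (existT _ P (existT _ k (exist _ p (conj kp Pp))))).
pose c Z := sval (cid (hc Z)).
pose K Z := projT1 (c Z); pose P Z := projT1 (projT2 (c Z)).
pose k Z : hom (K Z) (P Z) := projT1 (projT2 (projT2 (c Z))).
pose p Z : hom (P Z) Z := sval (projT2 (projT2 (projT2 (c Z)))).
have kp Z : ses (k Z) (p Z) := (svalP (projT2 (projT2 (projT2 (c Z))))).1.
have Pp Z : projective (P Z) := (svalP (projT2 (projT2 (projT2 (c Z))))).2.
pose KX n := iter n K X.
pose d n : hom (P (KX n.+1)) (P (KX n)) := k (KX n) ∘ p (K (KX n)).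
have ex n : exact (d n.+1) (d n).
  apply/exactP; rewrite /d; split.
    by rewrite -compmA (compmA _ (k _)) (kp _).1.1 comp0m compm0.
  move=> Q y Qp; rewrite -compmA => /(ses_mono0 (kp _)) /(ses_lift (kp _)) [u <-].
  have [v <-] := Qp _ _ _ u (kp (K (KX n.+1))).2.
  by exists v; rewrite compmA.
constructor; apply: (@ProjResolution A X (fun n => P (KX n)) d (p X)) => //.
- exact: (kp X).2.
- apply/exactP; split; first by rewrite compmA (kp X).1.1 comp0m.
  move=> Q y Qp /(ses_lift (kp _)) [u <-].
  have [v <-] := Qp _ _ _ u (kp (K X)).2.
  by exists v; rewrite /d compmA.
Qed.

Lemma resolution_syzygy X (R : proj_resolution X) :
  exists K (k : hom K (R 0)) (e : hom (R 1) K),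
    [/\ ses k (res_aug R), epi e & k ∘ e = res_d R 0].
Proof.
have [K [k kr]] := ses_of_epi (@res_aug_epi _ _ R).
have [re0 rl] := proj1 (exactP _ _) (res_exact0 R).
have [e ke] := ses_lift kr re0.
exists K, k, e; split=> //; apply: epi_eltP => P y Pp.
have [|x xd] := rl P (k ∘ y) Pp; first by rewrite compmA kr.1.1 comp0m.
by exists x; apply: (kernel_mono kr.1); rewrite compmA ke.
Qed.

(** A cocycle on [R 1] is the same as a morphism on the first syzygy [K], because [e] is epi with
    kernel covered by [R 2]. It is a coboundary exactly when that morphism extends along [k]. *)
Lemma Ext_zero1P X D : Ext_zero 1 X D <-> ext1_zero X D.
Proof.
split=> [E | e1 R phi phi0].
  have [R] := exists_resolution X; have [K [k [e [kr ee ke]]]] := resolution_syzygy R.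
  apply: (ext1_zero_proj kr (@res_proj _ _ R 0)) => t.
  have [_ d10] := proj1 (exactP _ _) (res_exactS R 0).
  have [|s sd] := E R (t ∘ e).
    suff e0 : e ∘ res_d R 1 = 0 by rewrite -compmA e0 compm0.
    apply: (ses_mono0 kr); rewrite compmA ke.
    by case: (proj1 (exactP _ _) (res_exactS R 0)).
  by exists s; apply: ee; rewrite -compmA ke sd.
have [K [k [e [kr ee ke]]]] := resolution_syzygy R.
have [t te] : exists t, t ∘ e = phi.
  apply: (epi_desc ee) => P x Pp ex0.
  have [|y <-] := proj2 (proj1 (exactP _ _) (res_exactS R 0)) P x Pp.
    by rewrite -ke -compmA ex0 compm0.
  by rewrite compmA phi0 comp0m.
have [s sk] := e1 _ _ _ _ kr t.
by exists s; rewrite -ke compmA sk.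
Qed.

(** Transparent, so that the objects and differentials of [R] reappear one degree higher by
    conversion; this makes the dimension shift [Ext_zero_syzygy] immediate. *)
Definition splice X K P (k : hom K P) (p : hom P X) (Pp : projective P)
  (kp : ses k p) (R : proj_resolution K) : proj_resolution X.
Proof.
apply: (@ProjResolution A X (fun n => if n is m.+1 then R m else P)
  (fun n => match n return hom (R n) (if n is m.+1 then R m else P) with
            | 0 => k ∘ res_aug R | m.+1 => res_d R m end) p).
- by case=> // n; exact: (@res_proj _ _ R).
- exact: kp.2.
- apply/exactP; split; first by rewrite compmA kp.1.1 comp0m.
  move=> Q y Qp /(ses_lift kp) [u <-].
  have [v <-] := Qp _ _ _ u (@res_aug_epi _ _ R).
  by exists v; rewrite compmA.
- case=> [|n]; last exact: res_exactS.
  have [d0 dl] := proj1 (exactP _ _) (res_exact0 R).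
  apply/exactP; split; first by rewrite -compmA d0 compm0.
  by move=> Q y Qp; rewrite -compmA => /(ses_mono0 kp); exact: dl.
Defined.

Lemma Ext_zero_syzygy n X D K P (k : hom K P) (p : hom P X) :
  projective P -> ses k p -> Ext_zero n.+2 X D -> Ext_zero n.+1 K D.
Proof. by move=> Pp kp E R; exact: (E (splice Pp kp R)). Qed.

Definition tail_resolution X (R : proj_resolution X) K (k : hom K (R 0))
  (e : hom (R 1) K) (km : mono k) (ee : epi e) (ke : k ∘ e = res_d R 0) :
  proj_resolution K.
Proof.
apply: (@ProjResolution A K (fun n => R n.+1) (fun n => res_d R n.+1) e) => //.
- by move=> n; exact: (@res_proj _ _ R).
- have [d0 dl] := proj1 (exactP _ _) (res_exactS R 0).
  apply/exactP; split; first by apply: km; rewrite compmA ke d0 compm0.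
  move=> Q y Qp ey0; apply: dl => //.
  by rewrite -ke -compmA ey0 compm0.
- by move=> n; exact: res_exactS.
Defined.

(** As in Schanuel's lemma, the identity of [K] is [b ∘ a + h ∘ k], so [K] is a retract of the sum
    of [K'] and [P]. Lifts on these two summands combine to a lift on [K]. *)
Lemma ext1_zero_syzygy_indep X D K P (k : hom K P) (p : hom P X)
    K' P' (k' : hom K' P') (p' : hom P' X) :
  ses k p -> projective P -> ses k' p' -> projective P' ->
  ext1_zero K' D -> ext1_zero K D.
Proof.
move=> kp Pp kp' Pp' e1.
have [u pu] := Pp _ _ p' p kp'.2; have [v pv] := Pp' _ _ p p' kp.2.
have [|a ka] := @ses_lift _ _ _ _ _ _ (u ∘ k) kp'; first by rewrite compmA pu kp.1.1.
have [|b kb] := @ses_lift _ _ _ _ _ _ (v ∘ k') kp; first by rewrite compmA pv kp'.1.1.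
have [|h kh] := @ses_lift _ _ _ _ _ _ (idm P - v ∘ u) kp.
  by rewrite compBr compm1 compmA pv pu subrr.
have id_dec : idm K = b ∘ a + h ∘ k.
  apply: (kernel_mono kp.1); rewrite compDr !compmA kb kh compm1.
  by rewrite -(compmA v) ka compBl comp1m -compmA addrC subrK.
apply: ext1_lift_inv => E G f g x fg.
have [s gs] := ext1_lift e1 (x ∘ b) fg.
have [t gt] := Pp _ _ g (x ∘ h) fg.2.
exists (s ∘ a + t ∘ k).
by rewrite compDr !compmA gs gt -!compmA -compDr -id_dec compm1.
Qed.

End Abelian.

(** * Right exact functors *)

Section RightExact.
Variables (B : preadditive) (hB : abelian B) (hP : enough_projectives B).
Variables (F : additive_functor B B) (hF : right_exact F).

Lemma fmap_comp_eq (X Y Z : B) (g : hom Y Z) (f : hom X Y) (h : hom X Z) :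
  g ∘ f = h -> fmap F g ∘ fmap F f = fmap F h.
Proof. by move=> <-; rewrite fmapM. Qed.

Lemma fmap_epi (X Y : B) (f : hom X Y) : epi f -> epi (fmap F f).
Proof.
move=> fe; have [K [k kf]] := ses_of_epi hB fe.
by have [_] := hF (proj2 (short_exactP hB k f) kf).
Qed.

Lemma fmap_ses (X Y Z : B) (f : hom X Y) (g : hom Y Z) : ses f g ->
  forall P (y : hom P (F Y)), projective P -> fmap F g ∘ y = 0 ->
  exists x, fmap F f ∘ x = y.
Proof.
move=> fg; have [ex _] := hF (proj2 (short_exactP hB f g) fg).
by case: (proj1 (exactP hB hP _ _) ex).
Qed.

(** The hypothesis on [F] concerns short exact sequences, so [f] is factored as an epi [e] followed
    by the kernel [m] of [c]. Since [F e] is epi, a map killing [F f] kills [F m], whose image is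
    the kernel of [F c]. *)
Lemma fmap_cokernel (X Y C : B) (f : hom X Y) (c : hom Y C) :
  is_cokernel f c -> is_cokernel (fmap F f) (fmap F c).
Proof.
move=> cf; have [I [m mc]] := ses_of_epi hB (cokernel_epi cf).
have [e me] := ses_lift mc cf.1.
have ex : exact f c by exists I, m; split; [exists C, c; split=> //; exact: mc.1 | exact: mc.1].
have [_ exl] := proj1 (exactP hB hP _ _) ex.
have ee : epi e.
  apply: (epi_eltP hP) => P y Pp; have [|x fx] := exl P (m ∘ y) Pp.
    by rewrite compmA mc.1.1 comp0m.
  by exists x; apply: (kernel_mono mc.1); rewrite compmA me.
apply: cokernelI; first exact: fmap_epi (cokernel_epi cf).
  by rewrite (fmap_comp_eq cf.1) fmap0.
move=> W t tf0; apply: (epi_desc hB hP (fmap_epi (cokernel_epi cf))) => P x Pp.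
move=> /(fmap_ses mc Pp) [y <-].
have -> : t ∘ (fmap F m ∘ y) = t ∘ fmap F m ∘ y by rewrite compmA.
suff -> : t ∘ fmap F m = 0 by rewrite comp0m.
have /epi0P := fmap_epi ee; apply.
by rewrite -compmA (fmap_comp_eq me).
Qed.

End RightExact.

(** * The right trivial extension *)

Section TrivExt.
Variables (B : preadditive) (hB : abelian B) (hP : enough_projectives B).
Variables (F : additive_functor B B) (hF : right_exact F).
Hypothesis hF2 : forall M : B, is_zero_obj (F (F M)).
Notation A := (triv_ext F).

Lemma triv_homP (M N : A) (a : hom M N) :
  triv_val a ∘ triv_map M = triv_map N ∘ fmap F (triv_val a).
Proof. exact/eqP/(triv_valP a). Qed.

Definition triv_mk (M N : A) (a : hom (triv_car M) (triv_car N))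
  (e : a ∘ triv_map M = triv_map N ∘ fmap F a) : @hom A M N :=
  @TrivHom B F M N a (introT eqP e).

Lemma triv_ext_eq (M N : A) (a b : hom M N) : triv_val a = triv_val b -> a = b.
Proof. by move=> e; apply: val_inj. Qed.

Lemma triv_valD (M N : A) (a b : hom M N) :
  triv_val (a + b) = triv_val a + triv_val b.
Proof. by []. Qed.

Lemma triv_valM (M N L : A) (a : hom N L) (b : hom M N) :
  triv_val (a ∘ b) = triv_val a ∘ triv_val b.
Proof. by []. Qed.

Lemma FF0 (X Y : B) (f : hom (F (F X)) Y) : f = 0.
Proof. exact: (hF2 X).2. Qed.

Definition triv_on (X : B) (h : hom (F X) X) : A :=
  @TrivObj B F X h (FF0 (h ∘ fmap F h)).

Lemma triv_kernelI (M N K : A) (a : hom M N) (k : hom K M) :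
  is_kernel (triv_val a) (triv_val k) -> is_kernel a k.
Proof.
move=> ka; have km := kernel_mono ka; apply: kernelI.
- by move=> W x y /(congr1 (fun z => triv_val z)) /km /triv_ext_eq.
- exact/triv_ext_eq/ka.1.
- move=> W t /(congr1 (fun z => triv_val z)) /(kernel_lift ka) [u ku].
  have e : u ∘ triv_map W = triv_map K ∘ fmap F u.
    apply: km; rewrite !compmA ku triv_homP -ku.
    by rewrite fmapM compmA triv_homP.
  by exists (triv_mk e); apply: triv_ext_eq.
Qed.

Lemma triv_cokernelI (M N C : A) (a : hom M N) (c : hom N C) :
  is_cokernel (triv_val a) (triv_val c) -> is_cokernel a c.
Proof.
move=> ca; have ce := cokernel_epi ca; apply: cokernelI.
- by move=> W x y /(congr1 (fun z => triv_val z)) /ce /triv_ext_eq.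
- exact/triv_ext_eq/ca.1.
- move=> W t /(congr1 (fun z => triv_val z)) /(cokernel_desc ca) [u uc].
  have e : u ∘ triv_map C = triv_map W ∘ fmap F u.
    apply: (fmap_epi hB hF ce); rewrite -!compmA -triv_homP compmA uc triv_homP.
    by rewrite -uc fmapM.
  by exists (triv_mk e); apply: triv_ext_eq.
Qed.

Lemma triv_kernel_lift (M N : A) (a : hom M N) K (k : hom K (triv_car M)) :
  is_kernel (triv_val a) k ->
  exists (h : hom (F K) K) (k' : @hom A (triv_on h) M), triv_val k' = k.
Proof.
move=> ka; have [|h kh] := @kernel_lift _ _ _ _ _ _ _ (triv_map M ∘ fmap F k) ka.
  by rewrite compmA triv_homP -compmA (fmap_comp_eq F ka.1) fmap0 compm0.
exists h; have e : k ∘ triv_map (triv_on h) = triv_map M ∘ fmap F k by [].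
by exists (@triv_mk (triv_on h) M k e).
Qed.

(** Right exactness makes [F c] a cokernel of [F a], so [c ∘ triv_map N] descends to a structure map
    on [C]. *)
Lemma triv_cokernel_desc (M N : A) (a : hom M N) C (c : hom (triv_car N) C) :
  is_cokernel (triv_val a) c ->
  exists (h : hom (F C) C) (c' : @hom A N (triv_on h)), triv_val c' = c.
Proof.
move=> ca.
have [|h hc] := @cokernel_desc _ _ _ _ _ _ _ (c ∘ triv_map N) (fmap_cokernel hB hP hF ca).
  by rewrite -compmA -triv_homP compmA ca.1 comp0m.
exists h; have e : c ∘ triv_map N = triv_map (triv_on h) ∘ fmap F c by [].
by exists (@triv_mk N (triv_on h) c e).
Qed.

(** The kernel of [triv_val a] lifts to a morphism of the extension killed by [a], so it vanishes if
    [a] is mono. The converse is faithfulness of U. *)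
Lemma triv_monoP (M N : A) (a : hom M N) : mono a <-> mono (triv_val a).
Proof.
split=> am; last by move=> W x y /(congr1 (fun z => triv_val z)) /am /triv_ext_eq.
have [K [k ka]] := has_kernel hB (triv_val a).
have [h [k' ek]] := triv_kernel_lift ka.
have k0 : k' = 0.
  by have /mono0P := am; apply; apply: triv_ext_eq; rewrite triv_valM ek ka.1.
by apply/mono0P => W x /(kernel_lift ka) [u <-]; rewrite -ek k0 comp0m.
Qed.

Lemma triv_epiP (M N : A) (a : hom M N) : epi a <-> epi (triv_val a).
Proof.
split=> ae; last by move=> W x y /(congr1 (fun z => triv_val z)) /ae /triv_ext_eq.
have [C [c ca]] := has_cokernel hB (triv_val a).
have [h [c' ec]] := triv_cokernel_desc ca.
have c0 : c' = 0.
  by have /epi0P := ae; apply; apply: triv_ext_eq; rewrite triv_valM ec ca.1.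
by apply/epi0P => W x /(cokernel_desc ca) [u <-]; rewrite -ec c0 compm0.
Qed.

Lemma triv_kernelP (M N K : A) (a : hom M N) (k : hom K M) :
  is_kernel a k <-> is_kernel (triv_val a) (triv_val k).
Proof.
split=> [ka|]; last exact: triv_kernelI.
have [K' [k' ka']] := has_kernel hB (triv_val a).
have [h [k'' ek]] := triv_kernel_lift ka'.
have [|v kv] := @kernel_lift _ _ _ _ _ _ _ k'' ka.
  by apply: triv_ext_eq; rewrite triv_valM ek ka'.1.
apply: kernelI; first exact/triv_monoP/(kernel_mono ka).
  exact: (congr1 (fun z => triv_val z) ka.1).
move=> W t /(kernel_lift ka') [u <-]; exists (triv_val v ∘ u).
by rewrite -ek -kv compmA.
Qed.

Lemma triv_sesP (M N L : A) (a : hom M N) (b : hom N L) :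
  ses a b <-> ses (triv_val a) (triv_val b).
Proof.
by split=> -[/triv_kernelP ? /triv_epiP].
Qed.

Definition triv_bip (M N : A) : biproduct (triv_car M) (triv_car N) ->
  @biproduct A M N.
Proof.
move=> S.
pose m := bip_in1 S ∘ triv_map M ∘ fmap F (bip_pr1 S)
        + bip_in2 S ∘ triv_map N ∘ fmap F (bip_pr2 S).
have e1 : bip_in1 S ∘ triv_map M = triv_map (triv_on m) ∘ fmap F (bip_in1 S).
  rewrite /= /m compDl -!compmA !(fmap_comp_eq F (bip_pr1_in1 S)).
  by rewrite !(fmap_comp_eq F (bip_pr2_in1 S)) fmap1 fmap0 !compm0 compm1 addr0.
have e2 : bip_in2 S ∘ triv_map N = triv_map (triv_on m) ∘ fmap F (bip_in2 S).
  rewrite /= /m compDl -!compmA !(fmap_comp_eq F (bip_pr1_in2 S)).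
  by rewrite !(fmap_comp_eq F (bip_pr2_in2 S)) fmap1 fmap0 !compm0 compm1 add0r.
have e3 : bip_pr1 S ∘ triv_map (triv_on m) = triv_map M ∘ fmap F (bip_pr1 S).
  rewrite /= /m compDr !compmA bip_pr1_in1 bip_pr1_in2 !comp0m comp1m addr0.
  by [].
have e4 : bip_pr2 S ∘ triv_map (triv_on m) = triv_map N ∘ fmap F (bip_pr2 S).
  rewrite /= /m compDr !compmA bip_pr2_in1 bip_pr2_in2 !comp0m comp1m add0r.
  by [].
apply: (@Biproduct A M N (triv_on m)
  (@triv_mk M (triv_on m) _ e1) (@triv_mk N (triv_on m) _ e2)
  (@triv_mk (triv_on m) M _ e3) (@triv_mk (triv_on m) N _ e4)); apply: triv_ext_eq.
- exact: bip_pr1_in1.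
- exact: bip_pr2_in2.
- exact: bip_pr1_in2.
- exact: bip_pr2_in1.
- exact: bip_sum.
Defined.

Lemma triv_zero_obj (M : A) : is_zero_obj (triv_car M) -> is_zero_obj M.
Proof.
by move=> [z1 z2]; split=> N f; apply: triv_ext_eq; [rewrite (z1 _ (triv_val f)) | rewrite (z2 _ (triv_val f))].
Qed.

Lemma triv_abelian : abelian A.
Proof.
split.
- have [[Z Zz] _ _ _ _] := hB; exists (triv_on (0 : hom (F Z) Z)).
  exact: triv_zero_obj.
- move=> M N; have [S] := has_biproduct hB (triv_car M) (triv_car N).
  constructor; exact: triv_bip S.
- move=> M N a; have [K [k ka]] := has_kernel hB (triv_val a).
  have [h [k' ek]] := triv_kernel_lift ka.
  by exists (triv_on h), k'; apply: triv_kernelI; rewrite ek.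
- move=> M N a; have [K [k ka]] := has_cokernel hB (triv_val a).
  have [h [k' ek]] := triv_cokernel_desc ka.
  by exists (triv_on h), k'; apply: triv_cokernelI; rewrite ek.
- split=> M N a.
    move=> /triv_monoP am; have [K [k ka]] := has_cokernel hB (triv_val a).
    have [h [k' ek]] := triv_cokernel_desc ka.
    exists (triv_on h), k'; apply: triv_kernelI; rewrite ek.
    exact: mono_is_kernel ka.
  move=> /triv_epiP ae; have [K [k ka]] := has_kernel hB (triv_val a).
  have [h [k' ek]] := triv_kernel_lift ka.
  exists (triv_on h), k'; apply: triv_cokernelI; rewrite ek.
  exact: epi_is_cokernel ka.
Qed.

(* The bijection Hom(T X, N) = Hom(X, U N). *)
Lemma T_transpose_subproof (X : B) (S : biproduct X (F X)) (N : A)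
    (b : hom X (triv_car N)) (t := b ∘ bip_pr1 S +
      triv_map N ∘ fmap F b ∘ bip_pr2 S) :
  t ∘ triv_map (T_obj S) = triv_map N ∘ fmap F t.
Proof.
rewrite /t /= /T_map fmapD !compDl compDr !fmapM !compmA.
rewrite (comp_eq _ (bip_pr1_in2 S)) (comp_eq _ (bip_pr2_in2 S)) compm0 comp0m.
by rewrite compm1 (triv_sq N) !comp0m addr0 add0r.
Qed.

Definition T_transpose (X : B) (S : biproduct X (F X)) (N : A)
  (b : hom X (triv_car N)) : @hom A (T_obj S) N :=
  @triv_mk (T_obj S) N _ (T_transpose_subproof S b).

Lemma T_transpose_in1 (X : B) (S : biproduct X (F X)) (N : A)
  (b : hom X (triv_car N)) : triv_val (T_transpose S b) ∘ bip_in1 S = b.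
Proof.
rewrite /= compDl -!compmA bip_pr1_in1 bip_pr2_in1 !compm0 addr0.
exact: compm1.
Qed.

Lemma T_map_in1 (X : B) (S : biproduct X (F X)) :
  T_map S ∘ fmap F (bip_in1 S) = bip_in2 S.
Proof.
by rewrite /T_map -compmA (fmap_comp_eq F (bip_pr1_in1 S)) fmap1 compm1.
Qed.

(** The summand [F X] is the image of [F] of the summand [X] under the structure map, so
    compatibility with structure maps forces the value there. This is the uniqueness half of the
    adjunction. *)
Lemma T_obj_in2 (X : B) (S : biproduct X (F X)) (N : A) (a : @hom A (T_obj S) N) :
  triv_val a ∘ bip_in2 S = triv_map N ∘ fmap F (triv_val a ∘ bip_in1 S).
Proof.
by rewrite -(T_map_in1 S) compmA (triv_homP a) -compmA fmapM.
Qed.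

Lemma T_obj_ext (X : B) (S : biproduct X (F X)) (N : A) (a b : @hom A (T_obj S) N) :
  triv_val a ∘ bip_in1 S = triv_val b ∘ bip_in1 S -> a = b.
Proof.
move=> e1; apply: triv_ext_eq; apply: (bip_ext e1).
by rewrite !T_obj_in2 e1.
Qed.

Lemma T_transpose_epi (X : B) (S : biproduct X (F X)) (N : A)
  (b : hom X (triv_car N)) : epi b -> epi (T_transpose S b).
Proof.
move=> be; apply/triv_epiP => W x y e; apply: be.
by rewrite -(T_transpose_in1 S b) !compmA e.
Qed.

(** T is left adjoint to U, and U preserves epimorphisms. *)
Lemma T_projective (P : B) (S : biproduct P (F P)) :
  projective P -> @projective A (T_obj S).
Proof.
move=> Pp M N e f /triv_epiP ee.
have [g eg] := Pp _ _ _ (triv_val f ∘ bip_in1 S) ee.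
exists (T_transpose S g); apply: T_obj_ext.
by rewrite triv_valM -compmA T_transpose_in1 eg.
Qed.

Lemma triv_enough_projectives : enough_projectives A.
Proof.
move=> M; have [P [p [Pp pe]]] := hP (triv_car M).
have [S] := has_biproduct hB P (F P).
exists (T_obj S), (T_transpose S p); split; first exact: T_projective.
exact: T_transpose_epi.
Qed.

End TrivExt.
(** * Cotorsion pairs *)

Section Cotorsion.
Variables (A : preadditive) (hA : abelian A) (hP : enough_projectives A).
Variables (C D : A -> Prop) (hCD : cotorsion_pair C D).

Lemma cotorsion_ext1 X Y : C X -> D Y -> ext1_zero X Y.
Proof. by move=> CX DY; apply/(Ext_zero1P hA hP)/(hCD.1 X).1. Qed.

Lemma cotorsion_leftI X : (forall Y, D Y -> ext1_zero X Y) -> C X.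
Proof. by move=> e; apply/(hCD.1 X).2 => Y DY; apply/(Ext_zero1P hA hP)/e. Qed.

Lemma cotorsion_rightI Y : (forall X, C X -> ext1_zero X Y) -> D Y.
Proof. by move=> e; apply/(hCD.2 Y).2 => X CX; apply/(Ext_zero1P hA hP)/e. Qed.

Lemma cotorsion_left_retract X X' (i : hom X' X) (r : hom X X') :
  r ∘ i = idm X' -> C X -> C X'.
Proof.
move=> ri CX; apply: cotorsion_leftI => Y DY.
exact: (ext1_retract_l hA hP ri (cotorsion_ext1 CX DY)).
Qed.

Lemma cotorsion_right_retract Y Y' (i : hom Y' Y) (r : hom Y Y') :
  r ∘ i = idm Y' -> D Y -> D Y'.
Proof.
move=> ri DY; apply: cotorsion_rightI => X CX.
exact: (ext1_retract_r ri (cotorsion_ext1 CX DY)).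
Qed.

Lemma cotorsion_left_extension X1 X X2 (i : hom X1 X) (q : hom X X2) :
  ses i q -> C X1 -> C X2 -> C X.
Proof.
move=> iq C1 C2; apply: cotorsion_leftI => Y DY.
by apply: (ext1_extension_l hA hP iq); exact: cotorsion_ext1.
Qed.

Lemma cotorsion_right_extension Y1 Y Y2 (i : hom Y1 Y) (q : hom Y Y2) :
  ses i q -> D Y1 -> D Y2 -> D Y.
Proof.
move=> iq C1 C2; apply: cotorsion_rightI => X CX.
by apply: (ext1_extension_r hA hP iq); exact: cotorsion_ext1.
Qed.

Lemma cotorsion_zero Z : is_zero_obj Z -> core C D Z.
Proof.
move=> [z1 z2]; split.
  apply: cotorsion_leftI => Y _; apply: (ext1_lift_inv hA hP) => E G f g x _.
  by exists 0; rewrite compm0 (z2 _ x).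
by apply: cotorsion_rightI => X _ K E f g _ t; exists 0; rewrite comp0m (z1 _ t).
Qed.

(** Dimension shift: Ext^1 out of [K] vanishes because Ext^2 out of [X] does. *)
Lemma cotorsion_syzygy X K P (k : hom K P) (p : hom P X) :
  hereditary_pair C D -> projective P -> ses k p -> C X -> C K.
Proof.
move=> H Pp kp CX; apply/(hCD.1 K).2 => Y DY.
exact: (Ext_zero_syzygy hA hP Pp kp (H _ _ _ CX DY)).
Qed.

End Cotorsion.

(** * The free functor [T] *)

Section TExact.
Variables (B : preadditive) (hB : abelian B) (hP : enough_projectives B).
Variables (F : additive_functor B B) (hF : right_exact F).
Hypothesis hF2 : forall M : B, is_zero_obj (F (F M)).
Notation A := (triv_ext F).
Let hA : abelian A := triv_abelian hB hP hF hF2.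
Let hPA : enough_projectives A := triv_enough_projectives hB hP hF hF2.

(** The claim is proved first for the syzygy sequence of the resolution that computes L_1 F, then
    carried over to an arbitrary sequence by [comparison_ses]. *)
Lemma fmap_mono (M K E : B) (f : hom K E) (g : hom E M) :
  left_derived_zero F 1 M -> ses f g -> mono (fmap F f).
Proof.
move=> L0 fg; have [R] := exists_resolution hB hP M.
have [K0 [k0 [e [kr ee ke]]]] := resolution_syzygy hB hP R.
have [dd0 dl] := proj1 (exactP hB hP _ _) (res_exactS R 0).
have ed : e ∘ res_d R 1 = 0 by apply: (ses_mono0 kr); rewrite compmA ke.
have [Z [z zd]] := has_kernel hB (fmap F (res_d R 0)).
have [|d' zd'] := @kernel_lift _ _ _ _ _ _ _ (fmap F (res_d R 1)) zd.
  by rewrite (fmap_comp_eq F dd0) fmap0.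
have [H [c cd]] := has_cokernel hB d'.
have [_ H0] : is_zero_obj H by apply: L0; exists R, Z, z, d', c.
have d'e : epi d'.
  by apply/epi0P => W x /(cokernel_desc cd) [u <-]; rewrite (H0 _ u) comp0m.
(* An element of [F K0] killed by [F k0] lifts to a cycle in [F (R 1)]. As the homology vanishes,
   the cycle is a boundary, and boundaries die in [F K0] because [e ∘ res_d R 1 = 0]. *)
have k0m (P : B) (x : hom P (F K0)) : projective P -> fmap F k0 ∘ x = 0 -> x = 0.
  move=> Pp kx0; have [y ey] := Pp _ _ _ x (fmap_epi hB hF ee).
  have [|y' zy] := @kernel_lift _ _ _ _ _ _ _ y zd.
    by rewrite -ke fmapM -compmA ey.
  have [w dw] := Pp _ _ _ y' d'e.
  by rewrite -ey -zy -dw (compmA z) zd' compmA (fmap_comp_eq F ed) fmap0 comp0m.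
have [a [b [ga fb S]]] := comparison_ses hB hP fg kr (@res_proj _ _ R 0).
have [bp] := has_biproduct hB K (R 0).
apply: (mono_eltP hP) => P x Pp fx0.
(* Placed in the first summand, [x] is killed by [F] of the comparison epi, so it comes from some
   [y] in [F K0]. The second component gives [F k0 ∘ y = 0], hence [y = 0] and [x = 0]. *)
have [|y yE] := fmap_ses hB hP hF (S bp) (y := fmap F (bip_in1 bp) ∘ x) Pp.
  rewrite compmA -fmapM compDl -!compmA bip_pr1_in1 bip_pr2_in1 compm1 compm0.
  by rewrite addr0.
have y0 : y = 0.
  apply: k0m => //; have := congr1 (fun w => fmap F (bip_pr2 bp) ∘ w) yE.
  rewrite !compmA -!fmapM compBr !compmA bip_pr2_in2 bip_pr2_in1 comp1m !comp0m.
  by rewrite subr0 fmap0 comp0m.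
have := congr1 (fun w => fmap F (bip_pr1 bp) ∘ w) yE.
by rewrite y0 !compm0 compmA (fmap_comp_eq F (bip_pr1_in1 bp)) fmap1 comp1m.
Qed.

(** Defined by transposition, so that functoriality follows from uniqueness of transposes. The
    biproducts are parameters because [T_obj] depends on a chosen one. *)
Definition T_fmap (X X' : B) (S : biproduct X (F X)) (S' : biproduct X' (F X'))
  (f : hom X X') : @hom A (T_obj S) (T_obj S') :=
  @T_transpose _ _ _ S (T_obj S') (bip_in1 S' ∘ f).

Section TFmap.
Variables (X X' : B) (S : biproduct X (F X)) (S' : biproduct X' (F X')).

Lemma T_fmap_in1 f : triv_val (T_fmap S S' f) ∘ bip_in1 S = bip_in1 S' ∘ f.
Proof. exact: T_transpose_in1. Qed.

Lemma T_fmapE f : triv_val (T_fmap S S' f) =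
  bip_in1 S' ∘ f ∘ bip_pr1 S + bip_in2 S' ∘ fmap F f ∘ bip_pr2 S.
Proof. by rewrite /= fmapM compmA T_map_in1. Qed.

Lemma T_fmap_pr1 f : bip_pr1 S' ∘ triv_val (T_fmap S S' f) = f ∘ bip_pr1 S.
Proof.
by rewrite T_fmapE compDr !compmA bip_pr1_in1 bip_pr1_in2 comp1m !comp0m addr0.
Qed.

Lemma T_fmap_pr2 f :
  bip_pr2 S' ∘ triv_val (T_fmap S S' f) = fmap F f ∘ bip_pr2 S.
Proof.
by rewrite T_fmapE compDr !compmA bip_pr2_in1 bip_pr2_in2 comp1m !comp0m add0r.
Qed.

End TFmap.

Lemma T_fmap1 (X : B) (S : biproduct X (F X)) : T_fmap S S (idm X) = idm _.
Proof. by apply: T_obj_ext; rewrite T_fmap_in1 compm1 comp1m. Qed.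

Lemma T_transpose_nat (X X' : B) (S : biproduct X (F X)) (S' : biproduct X' (F X'))
    (M : A) (b : hom X' (triv_car M)) (f : hom X X') :
  T_transpose S' b ∘ T_fmap S S' f = T_transpose S (b ∘ f).
Proof.
apply: T_obj_ext; rewrite triv_valM -compmA T_fmap_in1 compmA.
by rewrite !T_transpose_in1.
Qed.

Lemma T_transpose_natr (X : B) (S : biproduct X (F X)) (M N : A) (a : hom M N) (b : hom X (triv_car M)) :
  a ∘ T_transpose S b = T_transpose S (triv_val a ∘ b).
Proof. by apply: T_obj_ext; rewrite triv_valM -compmA !T_transpose_in1. Qed.

Lemma T_fmapM (X X' X'' : B) (S : biproduct X (F X)) (S' : biproduct X' (F X'))
    (S'' : biproduct X'' (F X'')) (g : hom X' X'') (f : hom X X') :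
  T_fmap S S'' (g ∘ f) = T_fmap S' S'' g ∘ T_fmap S S' f.
Proof. by rewrite [RHS]T_transpose_nat /T_fmap compmA. Qed.

Lemma T_fmapD (X X' : B) (S : biproduct X (F X)) (S' : biproduct X' (F X'))
    (f g : hom X X') : T_fmap S S' (f + g) = T_fmap S S' f + T_fmap S S' g.
Proof.
by apply: T_obj_ext; rewrite triv_valD compDl !T_fmap_in1 compDr.
Qed.

(** In components T acts diagonally by [f] and [F f], so the sequence is the direct sum of the given
    one and its image under [F]. *)
Lemma T_fmap_ses (X X' X'' : B) (S : biproduct X (F X)) (S' : biproduct X' (F X'))
    (S'' : biproduct X'' (F X'')) (f : hom X X') (g : hom X' X'') :
  ses f g -> mono (fmap F f) -> ses (T_fmap S S' f) (T_fmap S' S'' g).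
Proof.
move=> fg Fm; apply/(triv_sesP hB hP hF hF2).
have [Ff Fe] : is_kernel (fmap F g) (fmap F f) /\ epi (fmap F g).
  split; last exact: fmap_epi fg.2.
  apply: (kernel_eltI hB hP Fm).
    by rewrite (fmap_comp_eq F fg.1.1) fmap0.
  by move=> P t Pp; exact: (fmap_ses hB hP hF fg Pp).
apply: (ses_eltI hB hP).
- apply: bip_elt_ext; rewrite compmA ?T_fmap_pr1 ?T_fmap_pr2 -compmA
    ?T_fmap_pr1 ?T_fmap_pr2 compmA ?fg.1.1 ?Ff.1 comp0m compm0 //.
- move=> P x _ x0; apply: bip_elt_ext; rewrite compm0.
    apply: (ses_mono0 fg); rewrite compmA -(T_fmap_pr1 S S') -compmA x0 compm0 //.
  by apply: (proj1 (mono0P _) Fm); rewrite compmA -(T_fmap_pr2 S S') -compmA x0 compm0.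
- move=> P t Pp t0.
  have [|u fu] := @ses_lift _ _ _ _ _ _ _ (bip_pr1 S' ∘ t) fg.
    by rewrite compmA -(T_fmap_pr1 S' S'') -compmA t0 compm0.
  have [|v fv] := @kernel_lift _ _ _ _ _ _ _ (bip_pr2 S' ∘ t) Ff.
    by rewrite compmA -(T_fmap_pr2 S' S'') -compmA t0 compm0.
  exists (bip_in1 S ∘ u + bip_in2 S ∘ v).
  apply: bip_elt_ext; rewrite compmA ?T_fmap_pr1 ?T_fmap_pr2 -compmA compDr !compmA
    ?bip_pr1_in1 ?bip_pr1_in2 ?bip_pr2_in1 ?bip_pr2_in2 !comp0m ?addr0 ?add0r comp1m //.
- move=> P y Pp.
  have [u gu] := Pp _ _ _ (bip_pr1 S'' ∘ y) fg.2.
  have [v gv] := Pp _ _ _ (bip_pr2 S'' ∘ y) Fe.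
  exists (bip_in1 S' ∘ u + bip_in2 S' ∘ v).
  apply: bip_elt_ext; rewrite compmA ?T_fmap_pr1 ?T_fmap_pr2 -compmA compDr !compmA
    ?bip_pr1_in1 ?bip_pr1_in2 ?bip_pr2_in1 ?bip_pr2_in2 !comp0m ?addr0 ?add0r comp1m //.
Qed.

(** T carries a projective presentation of [X] to one of [T X], since L_1 F vanishes at [X].
    Extension problems along the two presentations correspond under transposition. *)
Lemma T_ext1P (X : B) (S : biproduct X (F X)) (N : A) :
  left_derived_zero F 1 X ->
  ext1_zero (T_obj S) N <-> ext1_zero X (triv_car N).
Proof.
move=> L0; have [P [p [Pp pe]]] := hP X; have [K [k kp]] := ses_of_epi hB pe.
have [SP] := has_biproduct hB P (F P); have [SK] := has_biproduct hB K (F K).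
have Tkp := T_fmap_ses SK SP S kp (fmap_mono L0 kp).
split=> e1.
  apply: (ext1_zero_proj hB hP kp Pp) => t.
  have [s sE] := e1 _ _ _ _ Tkp (T_transpose SK t).
  exists (triv_val s ∘ bip_in1 SP).
  rewrite -(T_transpose_in1 SK t) -sE triv_valM -!compmA.
  by rewrite T_fmap_in1.
apply: (ext1_zero_proj hA hPA Tkp (T_projective hB hP hF hF2 (S := SP) Pp)) => t.
have [s sE] := e1 _ _ _ _ kp (triv_val t ∘ bip_in1 SK).
exists (T_transpose SP s); rewrite T_transpose_nat; apply: T_obj_ext.
by rewrite T_transpose_in1 sE.
Qed.

(** The retraction splits [M] as [X] plus [F M], and [F M] is identified with [F X] through
    [F p]. *)
Lemma T_classI (C : B -> Prop) (M : A) (r : hom (triv_car M) (F (triv_car M)))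
    (X : B) (p : hom (triv_car M) X) :
  r ∘ triv_map M = idm _ -> is_cokernel (triv_map M) p -> C X -> T_class F C M.
Proof.
set m := triv_map M => rm pm CX.
have mp : ses m p.
  by split; [exact: (mono_is_kernel hB (split_mono_mono rm) pm) | exact: cokernel_epi pm].
(* The kernel of [F p] is covered by [F (F M) = 0]. *)
have [q [qp pq]] : is_iso (fmap F p).
  apply: (mono_epi_iso hB); last exact: (fmap_epi hB hF mp.2).
  apply: (mono_eltP hP) => P x Pp /(fmap_ses hB hP hF mp Pp) [y <-].
  by rewrite (FF0 hF2 (fmap F m)) comp0m.
have [|i ip] := @ses_desc _ hB _ _ _ _ _ _ (idm _ - m ∘ r) mp.
  by rewrite compBl comp1m -compmA rm compm1 subrr.
have pe := mp.2; have pm0 := mp.1.1.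
(* With [m ∘ q] as second injection, the structure map of [T X] is [m ∘ q ∘ F p = m], so the
   identity of the underlying object is the required isomorphism. *)
unshelve epose (S := @Biproduct B X (F X) (triv_car M) i (m ∘ q) p (fmap F p ∘ r)
  _ _ _ _ _).
- by apply: pe; rewrite -compmA ip compBr compm1 compmA pm0 comp0m subr0 comp1m.
- by rewrite compmA (comp_eq _ rm) compm1.
- by rewrite compmA pm0 comp0m.
- apply: pe; rewrite -compmA ip compBr compm1 compmA (comp_eq _ rm) compm1.
  by rewrite subrr comp0m.
- by rewrite ip compmA -(compmA m) qp compm1 subrK.
exists X, S; split=> //.
have e1 : idm (triv_car M) ∘ triv_map M = triv_map (T_obj S) ∘ fmap F (idm _).
  by rewrite /= /T_map /= fmap1 compm1 comp1m -compmA qp compm1.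
have e2 : idm (triv_car M) ∘ triv_map (T_obj S) = triv_map M ∘ fmap F (idm _).
  by rewrite /= /T_map /= fmap1 compm1 comp1m -compmA qp compm1.
exists (@triv_mk _ _ M (T_obj S) _ e1), (@triv_mk _ _ (T_obj S) M _ e2).
by split; apply: triv_ext_eq; rewrite /= comp1m.
Qed.

Lemma T_class_retract (C : B -> Prop) (M : A) (X : B) (S : biproduct X (F X))
    (s : @hom A M (T_obj S)) (p : @hom A (T_obj S) M) :
  p ∘ s = idm M ->
  (forall Y (i : hom Y X) (r : hom X Y), r ∘ i = idm Y -> C Y) -> T_class F C M.
Proof.
move=> ps0 CX; have ps := congr1 (fun z => triv_val z) ps0.
rewrite triv_valM /= in ps; set s' := triv_val s in ps; set p' := triv_val p in ps.
have p'E : p' = p' ∘ bip_in1 S ∘ bip_pr1 S + p' ∘ bip_in2 S ∘ bip_pr2 S.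
  by rewrite -!compmA -compDr bip_sum compm1.
have [Y [c cm]] := has_cokernel hB (triv_map M).
(* The retraction passes through the summand [F X]. Composed with the structure map it is [F] of the
   part of [p' ∘ s'] through [X]; the part through [F X] is killed by [F], so this is [F (p' ∘ s')],
   the identity. *)
apply: (@T_classI C M (fmap F (p' ∘ bip_in1 S) ∘ bip_pr2 S ∘ s') Y c) => //.
  rewrite -compmA (triv_homP s) /= /T_map -!compmA (compmA (bip_pr2 S)) bip_pr2_in2.
  rewrite comp1m -!fmapM -fmap1 -ps -/s' {2}p'E compDl fmapD -/s'.
  rewrite -[X in _ = _ + fmap F X]compmA [X in _ = _ + X]fmapM.
  rewrite (FF0 hF2 (fmap F (p' ∘ bip_in2 S))) comp0m addr0.
  by rewrite !compmA.
have [|i ic] := @cokernel_desc _ _ _ _ _ _ _ (bip_pr1 S ∘ s') cm.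
  by rewrite -compmA (triv_homP s) /= /T_map !compmA bip_pr1_in2 !comp0m.
(* The cokernel [Y] is a retract of [X]: the part of [p' ∘ s'] through [F X] factors through the
   structure map of [M] and is killed by [c]. *)
apply: (CX Y i (c ∘ p' ∘ bip_in1 S)); apply: (cokernel_epi cm).
rewrite -compmA ic comp1m -[RHS]compm1 -[in RHS]ps {2}p'E compDl compDr !compmA.
have -> : c ∘ p' ∘ bip_in2 S = 0.
  by rewrite -compmA (T_obj_in2 p) compmA cm.1 comp0m.
by rewrite !comp0m addr0.
Qed.

(** The kernel consists of the pairs [(x, z)] with [b x + n (F b) z = 0], where [n] is the structure
    map of [N]. Those with [z = 0] form [K], and every [z] occurs because [b] is epi. *)
Lemma T_transpose_kernel (X K : B) (S : biproduct X (F X)) (N L : A)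
    (b : hom X (triv_car N)) (k : hom K X) (l : @hom A L (T_obj S)) :
  ses k b -> is_kernel (T_transpose S b) l ->
  exists (i : hom K (triv_car L)) (q : hom (triv_car L) (F X)), ses i q.
Proof.
set t := T_transpose S b => kb /(triv_kernelP hB hF2) lt.
have tE : triv_val t = b ∘ bip_pr1 S + triv_map N ∘ fmap F b ∘ bip_pr2 S by [].
have [|i li] := @kernel_lift _ _ _ _ _ _ _ (bip_in1 S ∘ k) lt.
  by rewrite compmA T_transpose_in1 kb.1.1.
have lm := kernel_mono lt.
exists i, (bip_pr2 S ∘ triv_val l); apply: (ses_eltI hB hP).
- by rewrite -compmA li compmA bip_pr2_in1 comp0m.
- move=> P x _ ix0; apply: (ses_mono0 kb).
  rewrite -[k]comp1m -(bip_pr1_in1 S) -(compmA _ _ k) -li -!compmA ix0.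
  by rewrite !compm0.
- move=> P y Pp qy0.
  have [|u ku] := @ses_lift _ _ _ _ _ _ _ (bip_pr1 S ∘ triv_val l ∘ y) kb.
    have := lt.1; rewrite tE compDl => /(congr1 (fun z => z ∘ y)).
    rewrite comp0m compDl -!compmA (compmA (bip_pr2 S)) qy0 !compm0 addr0.
    by [].
  exists u; apply: lm; rewrite compmA li; apply: (@bip_elt_ext _ _ _ S).
    by rewrite !compmA bip_pr1_in1 comp1m ku.
  by rewrite !compmA bip_pr2_in1 !comp0m qy0.
- move=> P z Pp.
  have [w bw] := Pp _ _ b (- (triv_map N ∘ fmap F b ∘ z)) kb.2.
  have [|y ly] := @kernel_lift _ _ _ _ _ _ _ (bip_in1 S ∘ w + bip_in2 S ∘ z) lt.
    rewrite tE compDl !compDr !compmA (comp_eq _ (bip_pr1_in1 S)).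
    rewrite (comp_eq _ (bip_pr1_in2 S)) (comp_eq _ (bip_pr2_in1 S)).
    by rewrite (comp_eq _ (bip_pr2_in2 S)) !compm0 !comp0m !compm1 bw addr0 add0r addNr.
  exists y; rewrite -compmA ly compDr !compmA bip_pr2_in1 bip_pr2_in2.
  by rewrite comp0m comp1m add0r.
Qed.

(* E is the pushout of T i : T U N -> T Y along the counit T U N -> N. *)
Lemma T_pushout_ses (N : A) (Y X : B) (SX : biproduct X (F X))
    (i : hom (triv_car N) Y) (p : hom Y X) :
  ses i p -> mono (fmap F i) ->
  exists (E : A) (j : hom N E) (q : @hom A E (T_obj SX)), ses j q /\
    exists (u : hom Y (triv_car E)) (v : hom (triv_car E) (F X)), ses u v.
Proof.
move=> ip Fi; have [SY] := has_biproduct hB Y (F Y).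
have [SN] := has_biproduct hB (triv_car N) (F (triv_car N)).
have [E [j [q [e [jq ei qe]]]]] := pushout_ses hA hPA (T_transpose SN (idm (triv_car N)))
  (T_fmap_ses SN SY SX ip Fi).
exists E, j, q; split=> //; move/(triv_sesP hB hP hF hF2): jq => jq.
have qe1 : triv_val q ∘ triv_val e ∘ bip_in1 SY = bip_in1 SX ∘ p.
  by rewrite -triv_valM qe T_fmap_in1.
have ei1 : triv_val e ∘ bip_in1 SY ∘ i = triv_val j.
  have := congr1 (fun z : @hom A (T_obj SN) E => triv_val z ∘ bip_in1 SN) ei.
  by rewrite !triv_valM -!compmA T_transpose_in1 compm1 T_fmap_in1.
(* The maps are [Y] to [T Y] to [E], and [E] to [T X] to [F X]; they exhibit the underlying object
   of [E] as an extension of [F X] by [Y]. *)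
exists (triv_val e ∘ bip_in1 SY), (bip_pr2 SX ∘ triv_val q).
apply: (ses_eltI hB hP).
- by rewrite !compmA -(compmA _ (triv_val q)) -compmA qe1 compmA bip_pr2_in1 comp0m.
- move=> P y Pp uy0.
  have [|n ny] := @ses_lift _ _ _ _ _ _ _ y ip.
    rewrite -[p]comp1m -(bip_pr1_in1 SX) -(compmA _ _ p) -qe1 -!compmA.
    by rewrite (compmA (triv_val e)) uy0 !compm0.
  suff n0 : n = 0 by rewrite -ny n0 compm0.
  by apply: (ses_mono0 jq); rewrite -ei1 -compmA ny.
- move=> P z Pp vz0.
  have [y py] := Pp _ _ p (bip_pr1 SX ∘ triv_val q ∘ z) ip.2.
  have [|n jn] := @ses_lift _ _ _ _ _ _ _ (z - triv_val e ∘ bip_in1 SY ∘ y) jq.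
    rewrite compBr !compmA qe1 -(compmA _ p) py; apply/eqP; rewrite subr_eq0; apply/eqP.
    apply: (@bip_elt_ext _ _ _ SX).
      by rewrite !compmA bip_pr1_in1 comp1m.
    by rewrite !compmA vz0 bip_pr2_in1 !comp0m.
  exists (i ∘ n + y); rewrite compDr compmA ei1 jn subrK.
  by [].
- move=> P y Pp; have [z qz] := Pp _ _ _ (bip_in2 SX ∘ y) jq.2.
  by exists z; rewrite -compmA qz compmA bip_pr2_in2 comp1m.
Qed.

End TExact.
(** * Functors out of a localization *)

Section LocalizationUniversal.
Variables (C D : category) (W : morphism_class C) (G : functor C D).
Hypothesis G_inv : forall (X Y : C) (s : hom X Y), @W X Y s -> is_iso (fmap G s).

Fixpoint loc_eval (X Y : C) (u : loc_word W X Y) : hom (G X) (G Y) :=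
  match u with
  | LMor _ _ f => fmap G f
  | LInv _ _ s Ws => sval (cid (G_inv Ws))
  | LComp _ _ _ v u => loc_eval v ∘ loc_eval u
  end.

Lemma loc_eval_rel (X Y : C) (u v : loc_word W X Y) :
  loc_rel u v -> loc_eval u = loc_eval v.
Proof.
elim=> {X Y u v} //=.
- by move=> X Y u v w _ -> _ ->.
- by move=> X Y Z v v' u u' _ -> _ ->.
- by move=> X Y Z T w v u; rewrite compmA.
- by move=> X Y u; rewrite fmap1 comp1m.
- by move=> X Y u; rewrite fmap1 compm1.
- by move=> X Y Z g f; rewrite fmapM.
- by move=> X Y s Ws; case: cid => g /= [-> _]; rewrite fmap1.
- by move=> X Y s Ws; case: cid => g /= [_ ->]; rewrite fmap1.
Qed.

Definition loc_lift_map (X Y : C) (f : @hom (localization W) X Y) :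
  hom (G X) (G Y) := loc_eval (repr (f : loc_hom W X Y)).

Lemma loc_lift_mapE (X Y : C) (u : loc_word W X Y) :
  loc_lift_map (\pi_(loc_hom W X Y) u)%qT = loc_eval u.
Proof. by apply: loc_eval_rel; apply/loc_homP; rewrite reprK. Qed.

Lemma loc_lift_map1 (X : C) : loc_lift_map (@idm (localization W) X) = idm (G X).
Proof. by rewrite [LHS]loc_lift_mapE /= fmap1. Qed.

Lemma loc_lift_mapM (X Y Z : C) (g : @hom (localization W) Y Z)
    (f : @hom (localization W) X Y) :
  loc_lift_map (g ∘ f) = loc_lift_map g ∘ loc_lift_map f.
Proof. exact: (loc_lift_mapE (LComp (repr g) (repr f))). Qed.

Definition loc_lift : functor (localization W) D :=
  @Functor (localization W) D G loc_lift_map loc_lift_map1 loc_lift_mapM.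

Lemma loc_lift_functor_map (X Y : C) (f : hom X Y) :
  fmap loc_lift (loc_functor_map W f) = fmap G f.
Proof. exact: loc_lift_mapE. Qed.

End LocalizationUniversal.

Lemma loc_functor_iso (C : category) (W : morphism_class C) (X Y : C)
  (s : hom X Y) : W X Y s -> is_iso (loc_functor_map W s).
Proof.
move=> Ws; exists (\pi_(loc_hom W Y X) (LInv s Ws))%qT.
split; rewrite [LHS]loc_comp_homE; apply/loc_homP; [exact: loc_invl | exact: loc_invr].
Qed.

(** Naturality need only be checked on morphisms of [C], by induction on words; at a formal inverse
    it follows from naturality at the morphism being inverted. *)
Lemma loc_nat_isomorphic (C D : category) (W : morphism_class C)
    (G H : functor (localization W) D)
    (eta : forall X : C, hom (G (X : localization W)) (H (X : localization W))) :
  (forall X, is_iso (eta X)) ->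
  (forall (X Y : C) (f : hom X Y), eta Y ∘ fmap G (loc_functor_map W f)
                                 = fmap H (loc_functor_map W f) ∘ eta X) ->
  nat_isomorphic G H.
Proof.
move=> eta_iso eta_nat; exists eta; split=> // X Y.
elim/quotW=> u; elim: u => {X Y} [X Y f|X Y s Ws|X Y Z v IHv u IHu].
- exact: eta_nat.
- set i : @hom (localization W) Y X := (\pi_(loc_hom W Y X) (LInv s Ws))%qT.
  have si : loc_functor_map W s ∘ i = idm _.
    by rewrite [LHS]loc_comp_homE; apply/loc_homP; exact: loc_invr.
  have is_ : i ∘ loc_functor_map W s = idm _.
    by rewrite [LHS]loc_comp_homE; apply/loc_homP; exact: loc_invl.
  rewrite -[LHS]comp1m -(fmap1 H) -is_ fmapM -!compmA (compmA _ (eta X)) -eta_nat.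
  by rewrite -!compmA -fmapM si fmap1 compm1.
- have -> : (\pi_(loc_hom W X Z) (LComp v u))%qT =
    (\pi_(loc_hom W Y Z) v : @hom (localization W) Y Z)%qT
      ∘ (\pi_(loc_hom W X Y) u : @hom (localization W) X Y)%qT.
    by rewrite [RHS]loc_comp_homE.
  by rewrite !fmapM compmA IHv -compmA IHu compmA.
Qed.

Lemma is_iso_comp (C : category) (X Y Z : C) (g : hom Y Z) (f : hom X Y) :
  is_iso g -> is_iso f -> is_iso (g ∘ f).
Proof.
move=> [g' [g'g gg']] [f' [f'f ff']]; exists (f' ∘ g'); split.
  by rewrite -compmA (compmA g') g'g comp1m.
by rewrite -compmA (compmA f) ff' comp1m.
Qed.

(** * The weak equivalences of a cotorsion pair *)

Section WeakEquivalences.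
Variables (A : preadditive) (hA : abelian A) (hP : enough_projectives A).
Variables (C D : A -> Prop) (hCD : cotorsion_pair C D).

(** The split mono is taken to be the identity, whose cokernel is a zero object and hence in the
    core. *)
Lemma weq_trivial_fibration (K X Y : A) (k : hom K X) (p : hom X Y) :
  ses k p -> D K -> weq_omega C D p.
Proof.
move=> kp DK; exists X, (idm X), p; split.
- by rewrite compm1.
- by exists (idm X); rewrite compm1.
- have [[Z Zz] _ _ _ _] := hA; exists Z, 0; split; last exact: cotorsion_zero Zz.
  apply: cokernelI; last first.
  + by move=> W t; rewrite compm1 => ->; exists 0; rewrite comp0m.
  + exact: comp0m.
  + by apply/epi0P => W x _; exact: (Zz.2 W x).
- exact: kp.2.
- by exists K, k; split=> //; exact: kp.1.
Qed.

(* A split mono with cokernel W has a retraction with kernel W. *)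
Lemma weq_omega_inverted (E : category) (G : functor A E) :
  (forall (K X Y : A) (k : hom K X) (p : hom X Y), ses k p -> D K ->
     is_iso (fmap G p)) ->
  forall (X Y : A) (f : hom X Y), weq_omega C D f -> is_iso (fmap G f).
Proof.
move=> Gp X Y f [Z [i [p [-> [r ri] [W [c [ci [_ DW]]]] pe [K [k [kp DK]]]]]]].
rewrite fmapM; apply: is_iso_comp; first exact: (Gp _ _ _ k).
have [|s sc] := @cokernel_desc _ _ _ _ _ _ _ (idm Z - i ∘ r) ci.
  by rewrite compBl comp1m -compmA ri compm1 subrr.
have ce := cokernel_epi ci.
have cs : c ∘ s = idm W.
  by apply: ce; rewrite -compmA sc compBr compm1 compmA ci.1 comp0m subr0 comp1m.
have sr : ses s r.
  split; last exact: split_epi ri.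
  apply: kernelI; first exact: split_mono_mono cs.
    by apply: ce; rewrite -compmA sc compBr compm1 compmA ri comp1m subrr comp0m.
  move=> V t rt0; exists (c ∘ t).
  by rewrite compmA sc compBl comp1m -compmA rt0 compm0 subr0.
have [r' [r'r rr']] := Gp _ _ _ s r sr DW.
have Gri : fmap G r ∘ fmap G i = idm _ by rewrite -fmapM ri fmap1.
have -> : fmap G i = r' by rewrite -[LHS]comp1m -r'r -compmA Gri compm1.
by exists (fmap G r).
Qed.

(** The sum [S] of [X] and [W] plays the part of a cylinder: [bip_pr1 S] is inverted, so its
    sections [bip_in1 S] and [bip_in1 S + bip_in2 S ∘ a] become equal. Composing them with
    [h = (g, b)] gives [g] and [f]. *)
Lemma loc_functor_map_core (X Y W : A) (f g : hom X Y) (a : hom X W) (b : hom W Y) :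
  f - g = b ∘ a -> core C D W ->
  loc_functor_map (weq_omega C D) f = loc_functor_map (weq_omega C D) g.
Proof.
move=> fg [_ DW]; have [S] := has_biproduct hA X W.
have [i [ip _]] := loc_functor_iso (weq_trivial_fibration (bip_ses (bip_swap S)) DW).
set L := loc_functor_map _ in i ip *.
have LM U V T (v : hom V T) (u : hom U V) : L _ _ (v ∘ u) = L _ _ v ∘ L _ _ u.
  exact: loc_functor_mapM.
have Le (e e' : hom X S) : bip_pr1 S ∘ e = bip_pr1 S ∘ e' -> L _ _ e = L _ _ e'.
  move=> /(congr1 (fun z => i ∘ L _ _ z)); rewrite !LM !compmA.
  rewrite (ip : i ∘ L _ _ (bip_pr1 S) = idm _).
  by rewrite !comp1m.
pose h := g ∘ bip_pr1 S + b ∘ bip_pr2 S.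
have -> : f = h ∘ (bip_in1 S + bip_in2 S ∘ a).
  rewrite compDr !compDl !compmA (comp_eq _ (bip_pr1_in1 S)).
  rewrite (comp_eq _ (bip_pr1_in2 S)) (comp_eq _ (bip_pr2_in1 S)).
  rewrite (comp_eq _ (bip_pr2_in2 S)) !compm0 comp0m !compm1 add0r addr0 -fg.
  by rewrite addrC subrK.
have -> : g = h ∘ bip_in1 S.
  by rewrite compDl -!compmA bip_pr1_in1 bip_pr2_in1 compm1 compm0 addr0.
rewrite !LM (Le _ (bip_in1 S)) //.
by rewrite compDr compmA bip_pr1_in2 comp0m addr0.
Qed.

End WeakEquivalences.

(** Makes epimorphisms with kernel in an extension-closed class stable under composition. *)
Lemma ses_comp_kernel (A : preadditive) (hA : abelian A) (hP : enough_projectives A)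
    (K X Y J Z : A) (k : hom K X) (p : hom X Y) (j : hom J Y) (e : hom Y Z) :
  ses k p -> ses j e ->
  exists (L : A) (l : hom L X) (a : hom K L) (b : hom L J), ses l (e ∘ p) /\ ses a b.
Proof.
move=> kp je.
have epe : epi (e ∘ p) by move=> W u v; rewrite !compmA => /kp.2 /je.2.
have [L [l lep]] := ses_of_epi hA epe.
have [|a la] := @ses_lift _ _ _ _ _ _ _ k lep; first by rewrite -compmA kp.1.1 compm0.
have [|b jb] := @ses_lift _ _ _ _ _ _ _ (p ∘ l) je; first by rewrite compmA lep.1.1.
have jm := kernel_mono je.1; have lm := kernel_mono lep.1.
exists L, l, a, b; split=> //; apply: (ses_eltI hA hP).
- by apply: jm; rewrite compmA jb -compmA la kp.1.1 compm0.
- by move=> P x _ ax0; apply: (ses_mono0 kp); rewrite -la -compmA ax0 compm0.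
- move=> P t _ bt0; have [|u ku] := @ses_lift _ _ _ _ _ _ _ (l ∘ t) kp.
    by rewrite compmA -jb -compmA bt0 compm0.
  by exists u; apply: lm; rewrite compmA la.
- move=> P y Pp; have [x px] := Pp _ _ p (j ∘ y) kp.2.
  have [|w lw] := @ses_lift _ _ _ _ _ _ _ x lep.
    by rewrite -compmA px compmA je.1.1 comp0m.
  by exists w; apply: jm; rewrite compmA jb -compmA lw.
Qed.
(** * The induced cotorsion pair *)

Section Main.
Variables (B : preadditive) (hB : abelian B) (hP : enough_projectives B).
Variables (F : additive_functor B B) (hF : right_exact F).
Hypothesis hF2 : forall M : B, is_zero_obj (F (F M)).
Variables (X Y : B -> Prop) (hXY : cotorsion_pair X Y).
Hypotheses (hcomplete : complete_pair X Y) (hhered : hereditary_pair X Y).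
Hypothesis hcf : contravariantly_finite (core X Y).
Hypothesis hL1 : forall M : B, X M -> left_derived_zero F 1 M.
Hypothesis hFX : forall M : B, X M -> Y (F M).
Notation A := (triv_ext F).
Notation TX := (T_class F X).
Notation UY := (Uinv_class F Y).
Let hA : abelian A := triv_abelian hB hP hF hF2.
Let hPA : enough_projectives A := triv_enough_projectives hB hP hF hF2.

Lemma T_class_T_obj (M : B) (S : biproduct M (F M)) : X M -> TX (T_obj S).
Proof.
move=> XM; exists M, S; split=> //; exists (idm (T_obj S : A)), (idm (T_obj S : A)).
by rewrite compm1.
Qed.

Lemma T_class_ext1P (M N : A) (M' : B) (S : biproduct M' (F M')) :
  X M' -> isomorphic M (T_obj S) ->
  ext1_zero M N <-> ext1_zero M' (triv_car N).
Proof.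
move=> XM [f [g [gf fg]]]; rewrite -(T_ext1P hB hP hF hF2 S N (hL1 XM)).
by split; apply: (ext1_retract_l hA hPA); [exact: fg | exact: gf].
Qed.

Lemma special_precover (N : A) : exists (K M : A) (k : hom K M) (p : hom M N),
  [/\ ses k p, TX M & UY K].
Proof.
have [[K [M [k [p [/(short_exactP hB) kp XM YK]]]]] _] := hcomplete (triv_car N).
have [S] := has_biproduct hB M (F M).
have te : epi (T_transpose S p) by exact: (T_transpose_epi hB hP hF hF2 kp.2).
have [L [l lt]] := ses_of_epi hA te.
exists L, (T_obj S), l, (T_transpose S p); split=> //; first exact: T_class_T_obj.
have [i [q iq]] := T_transpose_kernel hB hP hF2 kp lt.1.
exact: (cotorsion_right_extension hB hP hXY iq YK (hFX XM)).
Qed.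

Lemma T_cotorsion_pair : cotorsion_pair TX UY.
Proof.
have e1 (M N : A) : TX M -> UY N -> ext1_zero M N.
  move=> [M' [S [XM iM]]] YN; apply/(T_class_ext1P N XM iM).
  exact: (cotorsion_ext1 hB hP hXY XM YN).
split=> M; split.
- by move=> TM N YN; apply/(Ext_zero1P hA hPA)/e1.
(* The special precover of [M] splits, so [M] is a retract of an object of T(X). *)
- move=> e; have [K [L [k [p [kp [L' [S [XL [f [g [gf fg]]]]]] YK]]]]] := special_precover M.
  have e1K : ext1_zero M K by apply/(Ext_zero1P hA hPA)/e.
  have [s ps] := ext1_lift hA hPA e1K (idm M) kp.
  apply: (@T_class_retract _ hB hP _ hF hF2 X M L' S (f ∘ s) (p ∘ g)).
    by rewrite compmA -(compmA p) gf compm1 ps.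
  by move=> Z i r ri; exact: (cotorsion_left_retract hB hP hXY ri XL).
- by move=> YM N TN; apply/(Ext_zero1P hA hPA)/e1.
- move=> e; apply: (cotorsion_rightI hB hP hXY) => M' XM.
  have [S] := has_biproduct hB M' (F M').
  apply/(T_ext1P hB hP hF hF2 S M (hL1 XM))/(Ext_zero1P hA hPA)/e.
  exact: T_class_T_obj.
Qed.

Lemma T_complete_pair : complete_pair TX UY.
Proof.
move=> N; split.
  have [K [M [k [p [kp TM YK]]]]] := special_precover N.
  by exists K, M, k, p; split=> //; apply/(short_exactP hA).
have [_ [I [M [i [p [/(short_exactP hB) ip XM YI]]]]]] := hcomplete (triv_car N).
have [S] := has_biproduct hB M (F M).
have [E [j [q [jq [u [v uv]]]]]] :=
  T_pushout_ses hB hP hF hF2 S ip (fmap_mono hB hP hF (hL1 XM) ip).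
exists E, (T_obj S), j, q; split; first exact/(short_exactP hA).
  exact: T_class_T_obj.
exact: (cotorsion_right_extension hB hP hXY uv YI (hFX XM)).
Qed.

(** T of a projective presentation of [M'] is a second presentation, whose syzygy [T K'] is in T(X)
    by heredity in [B]; Ext^1 out of a syzygy vanishes for one presentation if it does for the
    other. *)
Lemma T_syzygy (M K P : A) (k : hom K P) (p : hom P M) :
  ses k p -> projective P -> TX M -> TX K.
Proof.
move=> kp Pp [M' [S [XM iM]]]; have [f [g [gf fg]]] := iM.
have [P' [p' [Pp' pe']]] := hP M'; have [K' [k' kp']] := ses_of_epi hB pe'.
have XK' := cotorsion_syzygy hB hP hXY hhered Pp' kp' XM.
have [SP] := has_biproduct hB P' (F P'); have [SK] := has_biproduct hB K' (F K').
have Tkp := T_fmap_ses hB hP hF hF2 SK SP S kp' (fmap_mono hB hP hF (hL1 XM) kp').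
have fkp : ses k (f ∘ p).
  split; last by move=> W u v; rewrite !compmA => /kp.2 /(split_epi fg).
  apply: kernelI; first exact: kernel_mono kp.1.
    by rewrite -compmA kp.1.1 compm0.
  move=> W t /(congr1 (fun z => g ∘ z)); rewrite compm0 !compmA gf comp1m.
  exact: ses_lift kp.
apply: (cotorsion_leftI hA hPA T_cotorsion_pair) => N YN.
apply: (ext1_zero_syzygy_indep hA hPA fkp Pp Tkp).
  exact: (T_projective hB hP hF hF2 (S := SP) Pp').
exact: (cotorsion_ext1 hA hPA T_cotorsion_pair (T_class_T_obj SK XK') YN).
Qed.

Lemma T_hereditary_pair : hereditary_pair TX UY.
Proof.
elim=> [|n IHn] M N TM YN; first exact: (T_cotorsion_pair.1 M).1.
move=> R; have [K [k [e [kr ee ke]]]] := resolution_syzygy hA hPA R.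
have TK := T_syzygy kr (@res_proj _ _ R 0) TM.
(* The tail of [R] resolves the syzygy [K] with degrees lowered by one, so the two statements agree
   by conversion. *)
exact: (IHn _ _ TK YN (tail_resolution hA hPA (kernel_mono kr.1) ee ke)).
Qed.

Lemma T_core (W : B) (S : biproduct W (F W)) : core X Y W -> core TX UY (T_obj S).
Proof.
move=> [XW YW]; split; first exact: T_class_T_obj.
exact: (cotorsion_right_extension hB hP hXY (bip_ses S) YW (hFX XW)).
Qed.

Lemma T_contravariantly_finite : contravariantly_finite (core TX UY).
Proof.
move=> N; have [W [w [cW wU]]] := hcf (triv_car N).
have [S] := has_biproduct hB W (F W).
exists (T_obj S), (T_transpose S w); split; first exact: T_core.
move=> M f [[M' [S' [XM [g [h [hg gh]]]]]] YM].
(* [M'] is a direct summand of the underlying object of [M], hence in the core of [B], and the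
   transposed morphism factors through [w]. *)
have YM' : Y M'.
  apply: (cotorsion_right_retract hB hP hXY
    (i := triv_val h ∘ bip_in1 S') (r := bip_pr1 S' ∘ triv_val g)) YM.
  have gh' : triv_val g ∘ triv_val h = idm _ := congr1 (fun z => triv_val z) gh.
  by rewrite -compmA (compmA (triv_val g)) gh' comp1m bip_pr1_in1.
have [a wa] := wU M' (triv_val (f ∘ h) ∘ bip_in1 S') (conj XM YM').
exists (T_fmap S' S a ∘ g).
rewrite compmA T_transpose_nat wa -[f in RHS]compm1 -hg compmA.
congr (_ ∘ g); apply: T_obj_ext; exact: T_transpose_in1.
Qed.

(** * The equivalence of homotopy categories *)

Local Notation L := (loc_functor_map (weq_omega X Y)).
Local Notation L' := (loc_functor_map (weq_omega TX UY)).

(** The biproduct is stored with the precover so that T of it is a definite object, on which a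
    functor can be defined. *)
Record precover (M : B) := Precover {
  pc_obj : B;
  pc_ker : B;
  pc_incl : hom pc_ker pc_obj;
  pc_map : hom pc_obj M;
  pc_ses : ses pc_incl pc_map;
  pc_left : X pc_obj;
  pc_right : Y pc_ker;
  pc_bip : biproduct pc_obj (F pc_obj) }.

Lemma exists_precover (M : B) : exists c : precover M, True.
Proof.
have [[K [Q [k [p [/(short_exactP hB) kp XQ YK]]]]] _] := hcomplete M.
by have [S] := has_biproduct hB Q (F Q); exists (Precover kp XQ YK S).
Qed.

Definition pc (M : B) : precover M := sval (cid (exists_precover M)).

Lemma precover_lift (M : B) (K Z N : B) (k : hom K Z) (p : hom Z N) (f : hom M N) :
  ses k p -> X M -> Y K -> exists g, p ∘ g = f.
Proof.
move=> kp XM YK.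
exact: (ext1_lift hB hP (cotorsion_ext1 hB hP hXY XM YK) f kp).
Qed.

(* Two lifts differ by a morphism from X to Y, which factors through the core. *)
Lemma T_fmap_lift_unique (M K Z N : B) (k : hom K Z) (p : hom Z N)
    (SM : biproduct M (F M)) (SZ : biproduct Z (F Z)) (f g : hom M Z) :
  ses k p -> X M -> Y K -> p ∘ f = p ∘ g -> L' (T_fmap SM SZ f) = L' (T_fmap SM SZ g).
Proof.
move=> kp XM YK fg.
have [|d kd] := @ses_lift _ _ _ _ _ _ _ (f - g) kp.
  by rewrite compBr fg subrr.
(* [W] is in the core, being also an extension of [M'] by [M]; the difference [d] extends to it
   because Ext^1(M', K) vanishes. *)
have [_ [W [M' [i [q [/(short_exactP hB) iq XM' YW]]]]]] := hcomplete M.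
have [d' d'i] := cotorsion_ext1 hB hP hXY XM' YK iq d.
have XW := cotorsion_left_extension hB hP hXY iq XM XM'.
have [S] := has_biproduct hB W (F W).
apply: (loc_functor_map_core hA hPA T_cotorsion_pair
  (a := T_fmap SM S i) (b := T_fmap S SZ (k ∘ d'))); last exact: T_core.
rewrite -T_fmapM -compmA d'i kd; apply/eqP; rewrite subr_eq -T_fmapD.
by rewrite subrK.
Qed.

Definition pc_lift (M N : B) (f : hom M N) : hom (pc_obj (pc M)) (pc_obj (pc N)) :=
  sval (cid (precover_lift (f ∘ pc_map (pc M)) (pc_ses (pc N)) (pc_left (pc M))
    (pc_right (pc N)))).

Lemma pc_liftE (M N : B) (f : hom M N) :
  pc_map (pc N) ∘ pc_lift f = f ∘ pc_map (pc M).
Proof. exact: (svalP (cid (precover_lift _ _ _ _))). Qed.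

(** Lifts to precovers are not unique, so the assignment becomes functorial only after
    localization. *)
Definition LT_map (M N : B) (f : hom M N) :=
  L' (T_fmap (pc_bip (pc M)) (pc_bip (pc N)) (pc_lift f)).

Lemma LT_mapE (M N : B) (f : hom M N) (g : hom (pc_obj (pc M)) (pc_obj (pc N))) :
  pc_map (pc N) ∘ g = f ∘ pc_map (pc M) ->
  LT_map f = L' (T_fmap (pc_bip (pc M)) (pc_bip (pc N)) g).
Proof.
move=> gE; apply: (T_fmap_lift_unique _ _ (pc_ses (pc N))).
- exact: pc_left.
- exact: pc_right.
- by rewrite pc_liftE gE.
Qed.

Lemma LT_map1 (M : B) : LT_map (idm M) = idm _.
Proof. by rewrite (@LT_mapE _ _ _ (idm _)) ?T_fmap1 // compm1 comp1m. Qed.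

Lemma LT_mapM (M N Q : B) (g : hom N Q) (f : hom M N) :
  LT_map (g ∘ f) = LT_map g ∘ LT_map f.
Proof.
rewrite (@LT_mapE _ _ _ (pc_lift g ∘ pc_lift f)).
  by rewrite (T_fmapM _ (pc_bip (pc N))); exact: loc_functor_mapM.
by rewrite compmA pc_liftE -compmA pc_liftE compmA.
Qed.

Definition LT_functor : functor B (Ho (M_omega TX UY)) :=
  @Functor B (Ho (M_omega TX UY)) (fun M => T_obj (pc_bip (pc M))) LT_map
    LT_map1 LT_mapM.

(** The composite of [p] with the precover of [M] still has kernel in Y, so the precover of [N]
    lifts along it to [s]. Both composites with [pc_lift p] lift the same maps as identities, and T
    identifies such lifts in the localization. *)
Lemma LT_trivial_fibration (K M N : B) (k : hom K M) (p : hom M N) :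
  ses k p -> Y K -> is_iso (fmap LT_functor p).
Proof.
move=> kp YK.
have [J [j [a [b [jp ab]]]]] := ses_comp_kernel hB hP (pc_ses (pc M)) kp.
have YJ := cotorsion_right_extension hB hP hXY ab (pc_right _) YK.
have [s sE] := precover_lift (pc_map (pc N)) jp (pc_left (pc N)) YJ.
exists (L' (T_fmap (pc_bip (pc N)) (pc_bip (pc M)) s)); rewrite /= /LT_map.
split; apply: (etrans (esym (loc_functor_mapM (weq_omega TX UY) _ _)));
  rewrite -T_fmapM.
  rewrite (@T_fmap_lift_unique _ _ _ _ _ _ _ _ _ (idm _) jp) ?T_fmap1 //.
    exact: pc_left.
  by rewrite compmA sE pc_liftE compm1.
rewrite (@T_fmap_lift_unique _ _ _ _ _ _ _ _ _ (idm _) (pc_ses (pc N))) ?T_fmap1 //.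
- exact: pc_left.
- exact: pc_right.
- by rewrite compmA pc_liftE sE compm1.
Qed.

Definition LU_functor : functor A (Ho (M_omega X Y)) :=
  functor_comp (loc_functor (weq_omega X Y))
    (@Functor A B (@triv_car B F) (fun _ _ a => triv_val a)
      (fun _ => erefl) (fun _ _ _ _ _ => erefl)).

Lemma LU_trivial_fibration (K M N : A) (k : hom K M) (p : hom M N) :
  ses k p -> UY K -> is_iso (fmap LU_functor p).
Proof.
move=> /(triv_sesP hB hP hF hF2) kp YK.
exact/loc_functor_iso/(weq_trivial_fibration hB hP hXY kp).
Qed.

Lemma Ho_equivalent : cat_equivalent (Ho (M_omega X Y)) (Ho (M_omega TX UY)).
Proof.
pose LT : functor (Ho (M_omega X Y)) (Ho (M_omega TX UY)) :=
  loc_lift (weq_omega_inverted LT_trivial_fibration).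
pose LU : functor (Ho (M_omega TX UY)) (Ho (M_omega X Y)) :=
  loc_lift (weq_omega_inverted LU_trivial_fibration).
have LTE (M N : B) (f : hom M N) : fmap LT (L f) = LT_map f.
  exact: loc_lift_functor_map.
have LUE (M N : A) (a : hom M N) : fmap LU (L' a) = L (triv_val a).
  exact: loc_lift_functor_map.
exists LT, LU; split.
- pose eta (M : B) : @hom (Ho (M_omega X Y)) (functor_comp LU LT M) M :=
    L (pc_map (pc M) ∘ bip_pr1 (pc_bip (pc M))).
  apply: (@loc_nat_isomorphic _ _ (weq_omega X Y) (functor_comp LU LT)
    (functor_id (Ho (M_omega X Y))) eta).
  + move=> M; rewrite /eta [L _]loc_functor_mapM.
    apply: is_iso_comp; apply: loc_functor_iso.
      exact: (weq_trivial_fibration hB hP hXY (pc_ses _) (pc_right _)).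
    apply: (weq_trivial_fibration hB hP hXY (bip_ses (bip_swap _))).
    exact/hFX/pc_left.
  + move=> M N f.
    have -> : fmap (functor_comp LU LT) (L f) =
        L (triv_val (T_fmap (pc_bip (pc M)) (pc_bip (pc N)) (pc_lift f))).
      exact: (etrans (congr1 (fun z => fmap LU z) (LTE _ _ f)) (LUE _ _ _)).
    (* The naturality square commutes already in [B]. *)
    apply: (etrans (esym (loc_functor_mapM (weq_omega X Y) _ _))).
    apply: (etrans _ (loc_functor_mapM (weq_omega X Y) _ _)).
    by rewrite -compmA T_fmap_pr1 !compmA pc_liftE.
- pose eta (N : A) : @hom (Ho (M_omega TX UY)) (functor_comp LT LU N) N :=
    L' (T_transpose (pc_bip (pc (triv_car N))) (pc_map (pc (triv_car N)))).
  apply: (@loc_nat_isomorphic _ _ (weq_omega TX UY) (functor_comp LT LU)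
    (functor_id (Ho (M_omega TX UY))) eta).
  + move=> N; apply: loc_functor_iso.
    set S := pc_bip _; set p := pc_map _; have kp := pc_ses (pc (triv_car N)).
    have te : epi (T_transpose S p) by exact: (T_transpose_epi hB hP hF hF2 kp.2).
    have [J [l lt]] := ses_of_epi hA te.
    have [i [q iq]] := T_transpose_kernel hB hP hF2 kp lt.1.
    apply: (weq_trivial_fibration hA hPA T_cotorsion_pair lt).
    exact: (cotorsion_right_extension hB hP hXY iq (pc_right _) (hFX (pc_left _))).
  + move=> M N f.
    have -> : fmap (functor_comp LT LU) (L' f) = LT_map (triv_val f).
      exact: (etrans (congr1 (fun z => fmap LT z) (LUE _ _ f)) (LTE _ _ _)).
    apply: (etrans (esym (loc_functor_mapM (weq_omega TX UY) _ _))).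
    apply: (etrans _ (loc_functor_mapM (weq_omega TX UY) _ _)).
    by rewrite T_transpose_nat T_transpose_natr pc_liftE.
Qed.

End Main.

Theorem theorem3p20 (B : preadditive) (hB : abelian B)
    (hproj : enough_projectives B) (hinj : enough_injectives B)
    (F : additive_functor B B) (hF : right_exact F)
    (hF2 : forall M : B, is_zero_obj (F (F M)))
    (X Y : B -> Prop)
    (hXY : cotorsion_pair X Y) (hcomplete : complete_pair X Y)
    (hhered : hereditary_pair X Y)
    (hcf : contravariantly_finite (core X Y))
    (hL1 : forall M : B, X M -> left_derived_zero F 1 M)
    (hFX : forall M : B, X M -> Y (F M)) :
  [/\ cotorsion_pair (T_class F X) (Uinv_class F Y),
      complete_pair (T_class F X) (Uinv_class F Y),
      hereditary_pair (T_class F X) (Uinv_class F Y) &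
      contravariantly_finite (core (T_class F X) (Uinv_class F Y))] /\
  cat_equivalent (Ho (M_omega X Y))
                 (Ho (M_omega (T_class F X) (Uinv_class F Y))).
Proof.
split; last exact: Ho_equivalent.
split.
- exact: T_cotorsion_pair.
- exact: T_complete_pair.
- exact: T_hereditary_pair.
- exact: T_contravariantly_finite.
Qed.
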